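(* Suppose $n\ge1$ i.i.d. paths of an undiscounted ($\gamma=1$) Markov Reward Process are observed and that the Full Information Criterion applies to a state $s$. Then, on $\{N_s\ge 1\}$, the first-visit Monte Carlo estimator of $V_s$ is with probability one equal both to the minimum variance unbiased estimator (MVU) of $V_s$ and to the maximum likelihood (ML) value estimator of $V_s$.
   Context: A Markov Reward Process (MRP) has a finite state space $\mathbb S$, starting probabilities $p_i$, transition probabilities $p_{ij}$, random real rewards $R_{ij}$ received on a transition $i\to j$, and a discount $\gamma\in(0,1]$. Terminal states have no outgoing transitions and value $0$. For $\gamma=1$ a path reaches a terminal state after finitely many steps with probability one. The value is $V_i=\sum_j p_{ij}(\mathbb E[R_{ij}]+\gamma V_j)$. The possible starts and transitions are known; the probabilities (and reward parameters, if any) are unknown parameters. The sample consists of $n$ i.i.d. paths, each run until a terminal state, with their rewards; $N_s=K_s$ is the total number of visits to $s$. Standing assumption on rewards: the maximum likelihood estimate of the mean reward $\mathbb E[R_{ij}]$ is unbiased and coincides with the optimal unbiased estimate (e.g. deterministic, normal, binomial or multinomial rewards). First-visit Monte Carlo estimator $\bar V_s$: the average, over all observed paths that visit $s$, of the discounted sum of rewards following the first visit to $s$ in that path. MVU: $\mathbb E[\bar V_s\mid\mathcal S]$, where $\mathcal S$ is the minimal complete sufficient statistic of the MRP: numbers of starts in each state, the counts $\mu_{ij}$ of observed direct transitions $i\to j$ and, for random rewards, a complete sufficient statistic of the observed rewards that determines the total reward observed on each transition. ML value estimator: $\bar p_{ij}=\mu_{ij}/K_i$ ($\bar p_{ij}=0$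 if $K_i=0$), $\bar{\mathbf P}=(\bar p_{ij})$, $\bar r_i=\sum_j\bar p_{ij}\bar R_{ij}$ with $\bar R_{ij}$ the ML estimate of $\mathbb E[R_{ij}]$; the estimator is the vector $\sum_{t\ge0}\gamma^t\bar{\mathbf P}^t\bar{\mathbf r}=(\mathbf I-\gamma\bar{\mathbf P})^{-1}\bar{\mathbf r}$. Full Information Criterion for a state $s$: for every successor state $s'\neq s$ of $s$ (a state reachable from $s$ with positive probability) and every path $\pi$ that the MRP can generate, $\pi(i)=s'$ implies that there is $j<i$ with $\pi(j)=s$, where $\pi(i)$ is the $i$-th state of the path. *)

(* Defs.v *)
From HB Require Import structures.
From mathcomp Require Import all_boot all_order all_algebra.
From mathcomp Require Import all_classical all_reals all_analysis.

Set Implicit Arguments.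
Unset Strict Implicit.
Unset Printing Implicit Defensive.

Import Order.TTheory GRing.Theory Num.Theory.
Import numFieldNormedType.Exports.

Local Open Scope classical_set_scope.
Local Open Scope ring_scope.

Section Statistics.
Context (R : realType) (d : measure_display) (D : measurableType d).

Definition sigma_of (d' : measure_display) (U : measurableType d')
    (T : D -> U) : set_system D :=
  preimage_set_system [set: D] T measurable.

(* [Y] is a version of the conditional expectation of [X] given [G]. *)
Definition is_cond_exp (P : probability D R) (G : set_system D)
    (X Y : D -> R) : Prop :=
  [/\ P.-integrable [set: D] (EFin \o X),
      P.-integrable [set: D] (EFin \o Y),
      forall B : set R, measurable B -> G (Y @^-1` B)
    & forall A, G A ->
        (\int[P]_(x in A) (Y x)%:E = \int[P]_(x in A) (X x)%:E)%E].

Context (Lam : Type) (Q : Lam -> probability D R).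

(* Conditional expectations given [T] have a version that is free of the
   parameter; taking indicators for [h], the conditional law given [T] is. *)
Definition sufficient_stat (d' : measure_display) (U : measurableType d')
    (T : D -> U) : Prop :=
  forall h : D -> R,
    (forall l, (Q l).-integrable [set: D] (EFin \o h)) ->
    exists h' : D -> R, forall l, is_cond_exp (Q l) (sigma_of T) h h'.

Definition complete_stat (d' : measure_display) (U : measurableType d')
    (T : D -> U) : Prop :=
  forall g : U -> R, measurable_fun [set: U] g ->
    (forall l, (Q l).-integrable [set: D] (EFin \o (g \o T)) /\
               (\int[Q l]_x (g (T x))%:E = 0)%E) ->
    forall l, {ae Q l, forall x, g (T x) = 0}.

Definition determines (d' : measure_display) (U : measurableType d')
    (T : D -> U) (h : D -> R) : Prop :=
  exists2 g : U -> R, measurable_fun [set: U] g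
    & forall l, {ae Q l, forall x, h x = g (T x)}.

Definition unbiased (theta : Lam -> R) (W : D -> R) : Prop :=
  measurable_fun [set: D] W /\
  forall l, (Q l).-integrable [set: D] (EFin \o W) /\
            (\int[Q l]_x (W x)%:E = (theta l)%:E)%E.

Definition var_around (theta : Lam -> R) (W : D -> R) (l : Lam) : \bar R :=
  (\int[Q l]_x ((W x - theta l) ^+ 2)%:E)%E.

Definition optimal_unbiased (theta : Lam -> R) (W : D -> R) : Prop :=
  [/\ unbiased theta W,
      forall l, (var_around theta W l < +oo)%E
    & forall W', unbiased theta W' ->
        forall l, (var_around theta W l <= var_around theta W' l)%E].

End Statistics.

Section MRP.
Context (R : realType) (N : nat).

Notation pair := ('I_N * 'I_N)%type.

(* [rlaw l e] is the law of the reward on the transition [e]; it has density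
   [rdens l e] with respect to [rref e], an arbitrary measure so that discrete
   and continuous rewards are both covered. *)
Record reward_model := RewardModel {
  rpar : Type ;
  rlaw : rpar -> pair -> probability R R ;
  rref : pair -> {measure set R -> \bar R} ;
  rdens : rpar -> pair -> R -> R }.

(* The possible starts and transitions; these are known. *)
Context (start : {set 'I_N}) (edge : rel 'I_N).

Definition terminal (i : 'I_N) : bool := [forall j, ~~ edge i j].

Definition possible_path (xs : seq 'I_N) : bool :=
  if xs is i :: xs' then (i \in start) && path edge i xs' else false.

Definition full_information (s : 'I_N) : Prop :=
  forall s', s' != s -> connect edge s s' ->
  forall xs, possible_path xs ->
  forall i, (i < size xs)%N -> nth s xs i = s' ->
  exists2 j, (j < i)%N & nth s xs j = s.

Context (M : reward_model).

Definition rmean (l : rpar M) (e : pair) : R :=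
  (\int[rlaw l e]_(x in [set: R]) x)%R.

Definition reward_model_ok : Prop :=
  forall (l : rpar M) e, edge e.1 e.2 ->
  [/\ (rlaw l e).-integrable [set: R] (EFin \o id),
      measurable_fun [set: R] (rdens l e),
      forall x, 0 <= rdens l e x
    & forall B, measurable B ->
        rlaw l e B = (\int[rref M e]_(x in B) (rdens l e x)%:E)%E].

Record parameter := MRPParameter {
  init : 'rV[R]_N ;
  trans : 'M[R]_N ;
  rparam : rpar M }.

(* Rows of terminal states vanish, so the last limit says that the probability
   of making at least [t] transitions tends to [0]. *)
Definition valid (th : parameter) : Prop :=
  [/\ (forall i, 0 <= init th 0 i) /\ (\sum_i init th 0 i = 1),
      (forall i j, 0 <= trans th i j) /\
        (forall i, ~~ terminal i -> \sum_j trans th i j = 1),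
      forall i, (0 < init th 0 i) = (i \in start),
      forall i j, (0 < trans th i j) = edge i j
    & (\sum_i (init th *m trans th ^+ t) 0 i) @[t --> \oo] --> (0 : R)].

(* A vector of transition counts, and the space of the rewards observed for
   these counts: they are grouped by transition, each transition [e] filling
   [m e] consecutive places. *)
Definition counts := {ffun pair -> nat}.

Definition labels (m : counts) : seq pair :=
  flatten [seq nseq (m e) e | e <- enum {: pair}].

Definition robs (m : counts) := (size (labels m)).-tuple R.

Definition label (m : counts) (k : 'I_(size (labels m))) : pair :=
  tnth (in_tuple (labels m)) k.

Definition total_reward (m : counts) (e : pair) (y : robs m) : R :=
  \sum_(k | label k == e) tnth y k.

Definition feasible (m : counts) : Prop :=
  forall e, (0 < m e)%N -> edge e.1 e.2.

Definition independent_rewards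
    (Q : forall m : counts, rpar M -> probability (robs m) R) : Prop :=
  forall m l (B : 'I_(size (labels m)) -> set R),
    (forall k, measurable (B k)) ->
    Q m l [set y | forall k, B k (tnth y k)] =
    (\prod_k rlaw l (label k) (B k))%E.

Definition likelihood (m : counts) (l : rpar M) (y : robs m) : R :=
  \prod_k rdens l (label k) (tnth y k).

(* [r] maximizes the likelihood induced on the values of the mean reward. *)
Definition is_ml_mean (m : counts) (e : pair) (y : robs m) (r : R) : Prop :=
  forall l', ((likelihood l' y)%:E <=
    ereal_sup [set (likelihood l y)%:E | l in [set l | rmean l e = r]])%E.

Definition reward_assumption (Q : forall m : counts, rpar M -> probability (robs m) R)
    (d : measure_display) (U : measurableType d)
    (T : forall m : counts, robs m -> U)
    (rest : forall m : counts, pair -> robs m -> R) : Prop :=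
  (forall m, measurable_fun [set: robs m] (T m)) /\
  forall m, feasible m ->
  [/\ sufficient_stat (Q m) (T m),
      complete_stat (Q m) (T m),
      forall e, determines (Q m) (T m) (@total_reward m e)
    & forall e, (0 < m e)%N ->
        (forall l, {ae Q m l, forall y, is_ml_mean e y (rest m e y)}) /\
        optimal_unbiased (Q m) (rmean ^~ e) (rest m e)].

Section Sample.
Context (n : nat) (d : measure_display) (Omega : measurableType d).

(* [states k w] is the [k]-th path, ending with its terminal state, and
   [rewards k t w] the reward received on its transition from time [t] to time
   [t.+1]; values for later [t] are irrelevant. *)
Record sample := Sample {
  states : 'I_n -> Omega -> seq 'I_N ;
  rewards : 'I_n -> nat -> Omega -> R ;
  measurable_states : forall k xs, measurable [set w | states k w = xs] ;
  measurable_rewards : forall k t, measurable_fun [set: Omega] (rewards k t) }.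

Fixpoint path_law_from (th : parameter) (i : 'I_N) (xs : seq 'I_N)
    (B : nat -> set R) : \bar R :=
  if xs is j :: xs' then
    ((trans th i j)%:E * rlaw (rparam th) (i, j) (B 0%N) *
     path_law_from th j xs' (fun t => B t.+1))%E
  else if terminal i then 1%E else 0%E.

Definition path_law (th : parameter) (xs : seq 'I_N) (B : nat -> set R) :
    \bar R :=
  if xs is i :: xs' then ((init th 0 i)%:E * path_law_from th i xs' B)%E
  else 0%E.

Definition iid_sample (P : parameter -> probability Omega R) (Z : sample) :
    Prop :=
  forall th, valid th ->
  forall (xs : 'I_n -> seq 'I_N) (B : 'I_n -> nat -> set R),
    (forall k t, measurable (B k t)) ->
    P th [set w | forall k, states Z k w = xs k /\
                    forall t, (t.+1 < size (xs k))%N ->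
                      B k t (rewards Z k t w)] =
    (\prod_k path_law th (xs k) (B k))%E.

Context (Z : sample).

Definition visits (i : 'I_N) (w : Omega) : nat :=
  (\sum_k count_mem i (states Z k w))%N.

Definition path_return (gamma : R) (s : 'I_N) (k : 'I_n) (w : Omega) : R :=
  let xs := states Z k w in
  \sum_(index s xs <= t < (size xs).-1)
    gamma ^+ (t - index s xs) * rewards Z k t w.

(* This is [0] if no path visits [s]. *)
Definition first_visit_MC (gamma : R) (s : 'I_N) (w : Omega) : R :=
  (\sum_(k | s \in states Z k w) path_return gamma s k w) /
  #|[pred k | s \in states Z k w]|%:R.

Definition steps (xs : seq 'I_N) : seq pair := zip xs (behead xs).

Definition start_counts (w : Omega) : {ffun 'I_N -> nat} :=
  [ffun i => #|[pred k | ohead (states Z k w) == Some i]|].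

Definition mu (w : Omega) : counts :=
  [ffun e => (\sum_k count_mem e (steps (states Z k w)))%N].

Definition labelled_rewards (w : Omega) : seq (pair * R) :=
  flatten [seq zip (steps (states Z k w))
                   (mkseq (fun t => rewards Z k t w) (size (states Z k w)).-1)
          | k <- enum 'I_n].

Definition observed_rewards (w : Omega) : seq R :=
  flatten [seq [seq er.2 | er <- labelled_rewards w & er.1 == e]
          | e <- enum {: pair}].

(* To be used with [m = mu w] only. *)
Definition robs_of (m : counts) (w : Omega) : robs m :=
  [tuple nth 0 (observed_rewards w) k | k < size (labels m)].

Section SufficientStatistic.
Context (dU : measure_display) (U : measurableType dU)
  (T : forall m : counts, robs m -> U).

Definition suff_stat (w : Omega) : {ffun 'I_N -> nat} * counts * U :=
  (start_counts w, mu w, T (robs_of (mu w) w)).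

(* The sigma-algebra of [suff_stat], for the discrete sigma-algebra on the two
   (countable) types of counts. *)
Definition sigma_suff_stat : set_system Omega :=
  preimage_set_system [set: Omega] suff_stat
    [set C | forall a m, measurable [set u | C (a, m, u)]].

(* As the statistic is sufficient, the estimator does not depend on the
   parameter. *)
Definition is_MVU (P : parameter -> probability Omega R) (gamma : R)
    (s : 'I_N) (V : Omega -> R) : Prop :=
  forall th, valid th ->
    is_cond_exp (P th) sigma_suff_stat (first_visit_MC gamma s) V.

End SufficientStatistic.

Section MaximumLikelihood.
Context (rest : forall m : counts, pair -> robs m -> R).

Definition ml_trans (w : Omega) : 'M[R]_N :=
  \matrix_(i, j) ((mu w (i, j))%:R / (visits i w)%:R).

Definition ml_reward (w : Omega) : 'cV[R]_N :=
  \col_i \sum_j ml_trans w i j * rest (i, j) (robs_of (mu w) w).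

Definition ml_series (gamma : R) (s : 'I_N) (w : Omega) : R^nat :=
  series (fun t => gamma ^+ t * (ml_trans w ^+ t *m ml_reward w) s 0).

Definition ml_value (gamma : R) (s : 'I_N) (w : Omega) : R :=
  limn (ml_series gamma s w).

End MaximumLikelihood.
End Sample.
End MRP.

(* Main.v *)
Require Import Defs.
From HB Require Import structures.
From mathcomp Require Import all_boot all_order all_algebra.
From mathcomp Require Import all_classical all_reals all_analysis.
From mathcomp Require Import measurable_realfun zify ring lra.

Set Implicit Arguments.
Unset Strict Implicit.
Unset Printing Implicit Defensive.

Import Order.TTheory GRing.Theory Num.Theory.
Import numFieldNormedType.Exports.

Local Open Scope classical_set_scope.
Local Open Scope ring_scope.

(** Let [C] be the set of states reachable from [s]. By the Full Information
    Criterion a path enters [C] only at [s] and never leaves it, so all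
    transitions out of [C] that are observed at all follow a first visit to
    [s]. For [gamma = 1] the Monte Carlo estimate is therefore the total reward
    on transitions out of [C], divided by the number of paths through [s], and
    both are functions of the sufficient statistic: the estimate is its own
    conditional expectation.

    For the ML value, let [k] be the row vector of visit counts on [C], [P] the
    matrix of empirical transition frequencies and [q] the number of paths
    through [s]. Flow balance gives [k = q e_s + k P], hence
    [q sum_(t < T) e_s P^t r = k r - k P^T r]; here [k P^T] tends to [0] because
    every observed path ends in a terminal state. Finally [k r] is the total
    reward on transitions out of [C], since by a Lehmann-Scheffe argument the
    optimal unbiased estimate of a mean reward is the observed average.

    Integrability of the Monte Carlo estimate comes from the geometric decay of
    the probability that a path is still running. *)

(** * Paths *)

(** Two obstacles shape the proof. The estimate of a mean reward minimizes the variance, whereas the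
    observed average is a priori only integrable, so the square of their difference cannot be
    expanded and integrated at once. It is bounded on slices on which the average lies between [a]
    and [b]: the bound is quadratic in the width of the slice, and its sum over ever finer slices
    tends to zero.

    The assumptions on rewards concern fixed transition counts [m], while the counts of the sample
    are random and the space of observed rewards varies with them. Since [n] finite paths can be
    chosen in countably many ways, [Omega] splits into countably many events with constant paths. On
    each of them the rewards, put in the order of [labels], follow [Q m] up to the probability of
    the paths, and measurability, null sets and integrals are treated there. *)

Section PathCombinatorics.
Context (N : nat) (start : {set 'I_N}) (edge : rel 'I_N) (s : 'I_N).

(** The shape that sampled paths have almost surely: all other paths have weight zero
    ([path_weight_eq0]). *)
Definition complete_path (xs : seq 'I_N) : bool :=
  possible_path start edge xs && terminal edge (last s xs).

Lemma possible_path_edge xs t : possible_path start edge xs ->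
  (t.+1 < size xs)%N -> edge (nth s xs t) (nth s xs t.+1).
Proof.
case: xs => [//|x xs] /andP[_ /(pathP s) xsP] /=.
by rewrite ltnS => /xsP.
Qed.

Lemma possible_path_connect xs t u : possible_path start edge xs ->
  (t <= u)%N -> (u < size xs)%N -> connect edge (nth s xs t) (nth s xs u).
Proof.
move=> xsP; elim: u => [|u IH]; first by rewrite leqn0 => /eqP->.
rewrite leq_eqVlt => /predU1P[->//|tu] u_lt.
apply: connect_trans (IH tu (ltnW u_lt)) _.
by apply/connect1/possible_path_edge.
Qed.

(** The criterion enters here: a reachable state other than [s] has an earlier visit to [s], hence
    lies after the first one. On a path that misses [s] the index is the length of the path, and
    both sides are false. *)
Lemma connect_nth_index xs t : full_information start edge s ->
  possible_path start edge xs -> (t < size xs)%N ->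
  connect edge s (nth s xs t) = (index s xs <= t)%N.
Proof.
move=> fi xsP t_lt; apply/idP/idP => [st|it].
  have [ts|ts] := eqVneq (nth s xs t) s.
    rewrite leqNgt; apply/negP => /(before_find s) /=.
    by rewrite ts eqxx.
  have [j jt js] := fi _ ts st _ xsP _ t_lt erefl.
  rewrite (leq_trans _ (ltnW jt))// leqNgt; apply/negP => /(before_find s) /=.
  by rewrite js eqxx.
rewrite -{1}(nth_index s (_ : s \in xs)); last first.
  by rewrite -index_mem (leq_ltn_trans it).
exact: possible_path_connect.
Qed.

Lemma size_steps (xs : seq 'I_N) : size (steps xs) = (size xs).-1.
Proof. by rewrite /steps size_zip size_behead; case: xs => //= x xs; lia. Qed.

Lemma nth_steps (xs : seq 'I_N) t : (t < (size xs).-1)%N ->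
  nth (s, s) (steps xs) t = (nth s xs t, nth s xs t.+1).
Proof.
move=> t_lt; rewrite nth_zip_cond -/(steps xs) size_steps t_lt.
by rewrite nth_behead.
Qed.

Lemma drop_steps i (xs : seq 'I_N) : drop i (steps xs) = steps (drop i xs).
Proof.
by elim: xs i => [|x [|y xs] IH] [|i] //=; rewrite -IH.
Qed.

Lemma steps_edge xs e : possible_path start edge xs -> e \in steps xs ->
  edge e.1 e.2.
Proof.
move=> xsP /(nthP (s, s))[t]; rewrite size_steps => t_lt <-.
rewrite nth_steps//=; apply: possible_path_edge => //.
by move: t_lt; lia.
Qed.

Lemma filter_steps xs : full_information start edge s ->
  possible_path start edge xs ->
  [seq e <- steps xs | connect edge s e.1] = steps (drop (index s xs) xs).
Proof.
move=> fi xsP; rewrite -drop_steps -[in LHS](cat_take_drop (index s xs) (steps xs)).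
rewrite filter_cat -[RHS]cat0s; congr (_ ++ _).
  apply/eqP; rewrite -size_eq0 size_filter -leqn0 leqNgt -has_count.
  apply/hasPn => e /(nthP (s, s))[t].
  rewrite size_take_min leq_min => /andP[t1 t2] <-; rewrite nth_take//.
  rewrite size_steps in t2; rewrite nth_steps//= connect_nth_index//; lia.
apply/all_filterP/allP => e /(nthP (s, s))[t].
rewrite size_drop size_steps nth_drop => t_lt <-.
rewrite nth_steps/= ?connect_nth_index//; lia.
Qed.

Lemma sum_count_steps (a : pred 'I_N) (j : 'I_N) (l : seq ('I_N * 'I_N)) :
  (\sum_(i | a i) count_mem (i, j) l =
   count_mem j [seq e.2 | e <- l & a e.1])%N.
Proof.
elim: l => [|[x y] l IH] /=; first by rewrite big1.
rewrite big_split/= {}IH; case: ifP => ax /=; last first.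
  rewrite big1 ?add0n// => i ai; rewrite xpair_eqE.
  by case: eqVneq => //= xi; rewrite -xi ax in ai.
congr (_ + _)%N; rewrite (bigD1 x)//= xpair_eqE eqxx big1 ?addn0// => i.
by move=> /andP[_ /negbTE ix]; rewrite xpair_eqE eq_sym ix.
Qed.

Lemma map_snd_steps (xs : seq 'I_N) : [seq e.2 | e <- steps xs] = behead xs.
Proof. by rewrite -/(unzip2 _) unzip2_zip// size_behead leq_pred. Qed.

Lemma count_mem_path (xs : seq 'I_N) j :
  count_mem j xs =
  ((ohead xs == Some j) + \sum_i count_mem (i, j) (steps xs))%N.
Proof.
rewrite sum_count_steps filter_predT map_snd_steps; case: xs => //= x xs.
Qed.

Lemma drop_index_path xs :
  drop (index s xs) xs = if s \in xs then s :: behead (drop (index s xs) xs) else [::].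
Proof.
case: ifPn => [sxs|/memNindex->]; last by rewrite drop_size.
by rewrite [in LHS](drop_nth s) ?index_mem// nth_index// [in RHS](drop_nth s) ?index_mem//.
Qed.

(** Flow balance of a single path. Reachable states occur only from the first visit to [s] on, and
    in that suffix every state but the first is the end of a transition from a reachable state. *)
Lemma count_mem_closure xs j : full_information start edge s ->
  possible_path start edge xs -> connect edge s j ->
  (count_mem j xs = ((s \in xs) && (j == s)) +
     \sum_(i | connect edge s i) count_mem (i, j) (steps xs))%N.
Proof.
move=> fi xsP sj; rewrite sum_count_steps filter_steps// map_snd_steps.
rewrite -[in LHS](cat_take_drop (index s xs) xs) count_cat.
rewrite (_ : count_mem j (take _ _) = 0%N) ?add0n; last first.
  apply/eqP; rewrite -leqn0 leqNgt -has_count; apply/hasPn => x.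
  move=> /(nthP s)[t]; rewrite size_take_min leq_min => /andP[t1 t2] <-.
  rewrite nth_take//=; apply/negP => /eqP tj; move: sj.
  by rewrite -tj connect_nth_index// leqNgt t1.
rewrite [in LHS]drop_index_path; case: ifP => //= sxs; first by rewrite eq_sym.
by rewrite drop_index_path sxs.
Qed.

(** This makes the number of paths through [s] a function of the counts. A path gets to [s] from
    outside the reachable set at most once, by starting there or by a transition. Comparing two
    counts of the visits to [s] shows it: the transitions from inside cancel. *)
Lemma mem_start_count xs : full_information start edge s ->
  possible_path start edge xs ->
  ((s \in xs) = (ohead xs == Some s) +
     \sum_(i | ~~ connect edge s i) count_mem (i, s) (steps xs) :> nat)%N.
Proof.
move=> fi xsP; have := count_mem_closure fi xsP (connect0 edge s).
rewrite count_mem_path eqxx andbT (bigID (connect edge s))/= addnCA addnC.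
by move=> /addIn ->.
Qed.

Lemma sum_rewards_closure (R : realType) xs (r : nat -> R) :
  full_information start edge s -> possible_path start edge xs ->
  \sum_(er <- zip (steps xs) (mkseq r (size xs).-1) | connect edge s er.1.1)
    er.2 = \sum_(index s xs <= t < (size xs).-1) r t.
Proof.
move=> fi xsP; rewrite (big_nth ((s, s), 0)) size_zip size_steps size_mkseq minnn.
rewrite big_nat_cond [RHS]big_nat_cond.
rewrite [RHS](@big_nat_widenl _ _ _ _ 0%N)//.
apply: congr_big_nat => // t t_lt.
  rewrite nth_zip ?size_steps ?size_mkseq//= nth_steps; last by move: t_lt; lia.
  rewrite connect_nth_index//; last by move: t_lt; lia.
  by move: t_lt => /andP[_ ->] /=; rewrite !andbT andbb.
rewrite nth_zip ?size_steps ?size_mkseq//= nth_mkseq//.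
by move: t_lt; lia.
Qed.

End PathCombinatorics.

(** * Empirical chain *)

Section AbsorbingSeries.
Context (R : realType) (N : nat) (P : 'M[R]_N) (k : 'rV[R]_N) (q : R) (s : 'I_N).
Hypothesis q_gt0 : 0 < q.
Hypothesis P_ge0 : forall i j, 0 <= P i j.
Hypothesis k_ge0 : forall i, 0 <= k 0 i.
Hypothesis kE : k = q *: delta_mx 0 s + k *m P.
Hypothesis absorbing : forall L : 'rV[R]_N,
  (forall i, 0 <= L 0 i <= k 0 i) -> L = L *m P -> L = 0.

Lemma mulmx_ge0 m p l (A : 'M[R]_(m, p)) (B : 'M[R]_(p, l)) :
  (forall i j, 0 <= A i j) -> (forall i j, 0 <= B i j) ->
  forall i j, 0 <= (A *m B) i j.
Proof. by move=> A0 B0 i j; rewrite mxE sumr_ge0// => h _; rewrite mulr_ge0. Qed.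

Lemma mulmx_expr_ge0 t i j : 0 <= (P ^+ t) i j.
Proof.
elim: t i j => [|t IH] i j; first by rewrite expr0 mxE; case: (i == j).
by rewrite exprS -mulmxE; exact: mulmx_ge0.
Qed.

Let u t := k *m P ^+ t.

Let u_ge0 t i : 0 <= u t 0 i.
Proof. by apply: mulmx_ge0 => [a b|a b]; rewrite ?ord1// mulmx_expr_ge0. Qed.

(** The flow equation makes the decrement of [u] equal to [q] times the row that occurs in the
    series; this gives both monotonicity and telescoping. *)
Let uS t : u t.+1 = u t - q *: (delta_mx 0 s *m P ^+ t).
Proof.
have kP : k *m P = k - q *: delta_mx 0 s by rewrite {2}kE addrC addKr.
by rewrite /u exprS -mulmxE mulmxA kP mulmxBl scalemxAl.
Qed.

Let uSr t : u t.+1 = u t *m P.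
Proof. by rewrite /u exprSr -mulmxE mulmxA. Qed.

Let u_ni i : nonincreasing_seq (fun t => u t 0 i).
Proof.
apply/nonincreasing_seqP => t; rewrite uS -rowE !mxE gerBl mulr_ge0 ?mulmx_expr_ge0//.
exact: ltW.
Qed.

Let u_cvg i : cvgn (fun t => u t 0 i).
Proof.
apply: nonincreasing_is_cvgn; first exact: u_ni.
by exists 0 => _ [t _ <-]; exact: u_ge0.
Qed.

(** Each coordinate decreases and stays nonnegative, so it converges. The limit row is fixed by [P]
    and lies between 0 and [k], and the hypothesis [absorbing] excludes all such rows but zero. *)
Lemma stationary_limit0 i : (fun t => u t 0 i) @ \oo --> (0 : R).
Proof.
pose L : 'rV[R]_N := \row_i limn (fun t => u t 0 i).
suff L0 : L = 0.
  have := @u_cvg i; suff -> : limn (fun t => u t 0 i) = 0 by [].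
  by move/rowP/(_ i): L0; rewrite !mxE.
apply: absorbing => [j|].
  rewrite mxE; apply/andP; split.
    by apply: limr_ge; [exact: (@u_cvg _)|exact: nearW].
  have := nonincreasing_cvgn_ge (@u_ni j) (@u_cvg j) 0%N.
  by rewrite /u expr0 -/(1%:M) mulmx1.
apply/rowP => j; rewrite !mxE; apply/cvg_lim => //.
rewrite -cvg_shiftS /=.
under eq_fun => t do rewrite uSr mxE.
apply: cvg_big => [|h _]; first exact: add_continuous.
apply: cvgMl.
by rewrite mxE; exact: (@u_cvg _).
Qed.

Lemma absorbing_series_cvg (r : 'cV[R]_N) :
  series (fun t => 1 ^+ t * (P ^+ t *m r) s 0) @ \oo --> (k *m r) 0 0 / q.
Proof.
have partial T : series (fun t => 1 ^+ t * (P ^+ t *m r) s 0) T =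
    ((k *m r) 0 0 - (u T *m r) 0 0) / q.
  elim: T => [|T IH].
    by rewrite /series/= big_geq// /u expr0 mulmx1 subrr mul0r.
  have -> : (u T.+1 *m r) 0 0 = (u T *m r) 0 0 - q * (P ^+ T *m r) s 0.
    have entry (B : 'cV[R]_1) (A : 'cV[R]_N) :
      (B - q *: row s A) 0 0 = B 0 0 - q * A s 0 by rewrite !mxE.
    by rewrite uS mulmxBl -scalemxAl -mulmxA -rowE -row_mul entry.
  rewrite seriesSr IH expr1n mul1r; have q0 : q != 0 by rewrite gt_eqF.
  by field.
rewrite (funext partial).
apply: cvgMl; rewrite -[X in _ --> X]subr0; apply: cvgB; first exact: cvg_cst.
have -> : (0 : R) = \sum_(j < N) 0 * r j 0.
  by rewrite big1// => j _; rewrite mul0r.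
rewrite (_ : (fun T => _) = fun T => \sum_j u T 0 j * r j 0); last first.
  by apply/funext => T; rewrite mxE.
apply: cvg_big => [|j _]; first exact: add_continuous.
by apply: cvgMl; exact: stationary_limit0.
Qed.

End AbsorbingSeries.

Lemma sum_nat_gt0 (I : finType) (F : I -> nat) :
  (0 < \sum_i F i)%N = [exists i, 0 < F i]%N.
Proof.
rewrite lt0n sum_nat_eq0 negb_forall; apply: eq_existsb => i.
by rewrite implyTb lt0n.
Qed.

Section EmpiricalChain.
Context (R : realType) (N n : nat) (start : {set 'I_N}) (edge : rel 'I_N).
Context (s : 'I_N) (X : 'I_n -> seq 'I_N).

(** This and the next definitions restate the sample counts for bare paths, so that the empirical
    chain is studied without probability. At the paths of a sample point they are convertible with
    the originals. *)
Definition step_counts : counts N :=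
  [ffun e => (\sum_k count_mem e (steps (X k)))%N].

Definition visit_count (i : 'I_N) : nat := (\sum_k count_mem i (X k))%N.

Definition start_count (i : 'I_N) : nat := #|[pred k | ohead (X k) == Some i]|.

Definition path_count : nat := #|[pred k | s \in X k]|.

Definition empirical_trans : 'M[R]_N :=
  \matrix_(i, j) ((step_counts (i, j))%:R / (visit_count i)%:R).

Hypothesis X_complete : forall k, complete_path start edge s (X k).

Lemma complete_path_possible k : possible_path start edge (X k).
Proof. by case/andP: (X_complete k). Qed.

Lemma feasible_step_counts : feasible edge step_counts.
Proof.
move=> e; rewrite ffunE sum_nat_gt0 => /existsP[k]; rewrite /= -has_count has_pred1.
by move=> /(steps_edge s (complete_path_possible k)).
Qed.

Lemma step_count_gt0 k t : (t.+1 < size (X k))%N ->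
  (0 < step_counts (nth s (X k) t, nth s (X k) t.+1))%N.
Proof.
move=> t_lt; rewrite ffunE sum_nat_gt0; apply/existsP; exists k => /=.
have t_lt' : (t < (size (X k)).-1)%N by move: t_lt; lia.
by rewrite -has_count has_pred1 -nth_steps// mem_nth// size_steps.
Qed.

Lemma visit_count_gt0 i : (0 < visit_count i)%N -> exists k, i \in X k.
Proof.
rewrite sum_nat_gt0 => /existsP[k]; rewrite /= -has_count has_pred1 => ik.
by exists k.
Qed.

Lemma mem_visit_count k i : i \in X k -> (0 < visit_count i)%N.
Proof.
move=> ik; rewrite sum_nat_gt0; apply/existsP; exists k.
by rewrite /= -has_count has_pred1.
Qed.

(** A visit is followed by one transition, except a visit at the end of a path, which is followed by
    none. *)
Lemma sum_step_counts_le i : (\sum_j step_counts (i, j) <= visit_count i)%N.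
Proof.
under eq_bigr do rewrite ffunE; rewrite exchange_big leq_sum// => k _.
have -> : (\sum_j count_mem (i, j) (steps (X k)))%N =
    count_mem i (unzip1 (steps (X k))).
  elim: (steps _) => [|[x y] l IH] /=; first by rewrite big1.
  rewrite big_split/= {}IH; congr (_ + _)%N; rewrite (bigD1 y)//= xpair_eqE eqxx.
  rewrite andbT big1 ?addn0// => j /negbTE jy.
  by rewrite xpair_eqE eq_sym andbC eq_sym jy.
rewrite /steps; case: (X k) => //= x xs; elim: xs x => //= y xs IH x.
by rewrite leq_add2l IH.
Qed.

Lemma empirical_trans_ge0 i j : 0 <= empirical_trans i j.
Proof. by rewrite mxE divr_ge0. Qed.

Lemma sum_empirical_trans_le1 i : \sum_j empirical_trans i j <= 1.
Proof.
under eq_bigr do rewrite mxE; rewrite -mulr_suml -natr_sum.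
(* Division by zero gives zero, so the row of an unvisited state vanishes. *)
case: (posnP (visit_count i)) => [->|K0]; first by rewrite invr0 mulr0.
by rewrite ler_pdivrMr ?ltr0n// mul1r ler_nat sum_step_counts_le.
Qed.

Lemma step_counts_terminal z j : terminal edge z -> step_counts (z, j) = 0%N.
Proof.
move=> /forallP/(_ j)/negP zj; apply/eqP; rewrite -leqn0 leqNgt; apply/negP.
by move=> /feasible_step_counts.
Qed.

Let closed_visits : 'rV[R]_N :=
  \row_i (if connect edge s i then (visit_count i)%:R else 0).

(* Positive stationary mass would flow along an observed path to its terminal
   state, where it is lost. *)
Lemma empirical_absorbing (L : 'rV[R]_N) :
  (forall i, 0 <= L 0 i <= closed_visits 0 i) -> L = L *m empirical_trans ->
  L = 0.
Proof.
move=> Lk LP; apply/rowP => i; rewrite mxE; apply/eqP/negP => /negP Li0.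
have L0 j : 0 <= L 0 j by case/andP: (Lk j).
have Li : 0 < L 0 i by rewrite lt_neqAle eq_sym Li0 L0.
have [k ik] : exists k, i \in X k.
  apply: visit_count_gt0; case/andP: (Lk i) => _ /(lt_le_trans Li).
  by rewrite mxE; case: ifP; rewrite ?ltxx// ltr0n.
have Lpath t : (index i (X k) <= t)%N -> (t < size (X k))%N ->
    0 < L 0 (nth s (X k) t).
  elim: t => [|t IH].
    rewrite leqn0 => /eqP it _; suff -> : nth s (X k) 0 = i by [].
    by rewrite -it nth_index.
  rewrite leq_eqVlt => /predU1P[<- _|it t_lt]; first by rewrite nth_index.
  have Lt := IH it (ltnW t_lt); rewrite LP mxE (bigD1 (nth s (X k) t))//=.
  apply: ltr_wpDr.
    by apply: sumr_ge0 => h _; rewrite mulr_ge0 ?empirical_trans_ge0.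
  rewrite mulr_gt0// mxE divr_gt0// ltr0n ?step_count_gt0//.
  by apply: (@mem_visit_count k); rewrite mem_nth// ltnW.
have Xk0 : (0 < size (X k))%N by case: (X k) ik.
have := Lpath (size (X k)).-1; rewrite nth_last => Lz.
have {}Lz : 0 < L 0 (last s (X k)).
  by apply: Lz; rewrite ?prednK// -ltnS prednK// index_mem.
have /andP[_ zT] := X_complete k; set z := last s (X k) in Lz zT.
(* Stationarity preserves the total mass, yet the zero row of [z] passes nothing on and every other
   row at most the mass of its state. *)
have : \sum_j L 0 j <= \sum_(j | j != z) L 0 j.
  rewrite {1}LP; under eq_bigr do rewrite mxE.
  rewrite exchange_big/= (bigD1 z)//= big1 ?add0r.
    apply: ler_sum => j _; rewrite -mulr_sumr ler_piMr//.
    exact: sum_empirical_trans_le1.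
  by move=> j _; rewrite mxE step_counts_terminal// mul0r mulr0.
by rewrite (bigD1 z)//= gerDr leNgt Lz.
Qed.

Hypothesis fi : full_information start edge s.

(** Multiplying by the visit counts undoes the normalization of the frequencies, also at unvisited
    states, whose transition counts are zero. What remains is the sum of the flow balances of the
    single paths. *)
Lemma closed_visits_flow : closed_visits =
  path_count%:R *: delta_mx 0 s + closed_visits *m empirical_trans.
Proof.
apply/rowP => j; rewrite !mxE eqxx/=.
have -> : \sum_i closed_visits 0 i * empirical_trans i j =
    (\sum_(i | connect edge s i) step_counts (i, j))%:R.
  rewrite natr_sum [RHS]big_mkcond/=; apply: eq_bigr => i _; rewrite !mxE.
  case: ifP => _; last by rewrite mul0r.
  case: (posnP (visit_count i)) => [K0|K0]; last first.
    by rewrite mulrC divfK// pnatr_eq0 -lt0n.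
  rewrite K0 mul0r; apply/eqP; rewrite eq_sym pnatr_eq0 -leqn0 -K0.
  by rewrite (leq_trans _ (sum_step_counts_le i))// (bigD1 j)//= leq_addr.
case: ifPn => [sj|sj].
  rewrite -natrM -natrD; congr (_%:R); rewrite /visit_count.
  under eq_bigr do rewrite (count_mem_closure fi (complete_path_possible _) sj).
  rewrite big_split/=; congr (_ + _)%N.
    rewrite /path_count -sum1_card big_distrl/= [RHS]big_mkcond/=.
    by apply: eq_bigr => k _; rewrite inE; case: (s \in X k) => //=; rewrite mul1n.
  rewrite exchange_big/=; apply: eq_bigr => i _; by rewrite ffunE.
(* Here [j] is not reachable: it differs from [s], and no observed transition leads to it from a
   reachable state. *)
rewrite (_ : (j == s) = false) ?mulr0 ?add0r; last first.
  by apply: contraNF sj => /eqP ->; exact: connect0.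
apply/esym/eqP; rewrite pnatr_eq0 sum_nat_eq0; apply/forall_inP => i si.
rewrite -leqn0 leqNgt; apply/negP => /feasible_step_counts /= ij.
by move/negP: sj; apply; apply: connect_trans si (connect1 ij).
Qed.

Lemma path_count_from_counts : path_count =
  (start_count s + \sum_(i | ~~ connect edge s i) step_counts (i, s))%N.
Proof.
rewrite /path_count -sum1_card big_mkcond/=.
under eq_bigr => k _.
  rewrite (_ : (if _ then _ else _) = nat_of_bool (s \in X k)); last first.
    by rewrite inE; case: ifP.
  rewrite (mem_start_count fi (complete_path_possible k)); over.
rewrite big_split/=; congr (_ + _)%N.
  by rewrite /start_count -sum1_card [RHS]big_mkcond.
by rewrite exchange_big/=; apply: eq_bigr => i _; rewrite ffunE.
Qed.

Lemma path_count_gt0 : (0 < visit_count s)%N -> (0 < path_count)%N.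
Proof. by move=> /visit_count_gt0[k sk]; apply/card_gt0P; exists k. Qed.

(** The reward estimates [rho] are arbitrary: only their identification with observed averages needs
    probability, and it is made later. *)
Lemma empirical_value (rho : 'I_N * 'I_N -> R) : (0 < visit_count s)%N ->
  series (fun t => 1 ^+ t * (empirical_trans ^+ t *m
      (\col_i \sum_j empirical_trans i j * rho (i, j))) s 0) @ \oo -->
  (\sum_(e | connect edge s e.1) (step_counts e)%:R * rho e) / path_count%:R.
Proof.
move=> Ks; set r := \col_i _.
have -> : \sum_(e | connect edge s e.1) (step_counts e)%:R * rho e =
    (closed_visits *m r) 0 0.
  rewrite mxE.
  rewrite (eq_bigl (fun e : 'I_N * 'I_N => connect edge s e.1 && true)); last first.
    by move=> e; rewrite andbT.
  rewrite (eq_bigr (fun e : 'I_N * 'I_N =>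
    (step_counts (e.1, e.2))%:R * rho (e.1, e.2))); last by case.
  rewrite -(pair_big (connect edge s) predT (fun i j => (step_counts (i, j))%:R * rho (i, j)))/=.
  rewrite big_mkcond/=; apply: eq_bigr => i _; rewrite !mxE.
  case: ifP => _; last by rewrite mul0r.
  rewrite mulr_sumr; apply: eq_bigr => j _; rewrite mxE mulrA.
  case: (posnP (visit_count i)) => [K0|K0]; last first.
    by congr (_ * _); rewrite mulrC divfK// pnatr_eq0 -lt0n.
  suff -> : step_counts (i, j) = 0%N by rewrite !mul0r mulr0 mul0r.
  apply/eqP; rewrite -leqn0 -K0 (leq_trans _ (sum_step_counts_le i))//.
  by rewrite (bigD1 j)//= leq_addr.
apply: absorbing_series_cvg.
- by rewrite ltr0n path_count_gt0.
- exact: empirical_trans_ge0.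
- by move=> i; rewrite mxE; case: ifP.
- exact: closed_visits_flow.
- exact: empirical_absorbing.
Qed.

End EmpiricalChain.

(** * Optimal unbiased estimators *)

Section MeasureLemmas.
Context (R : realType) (d : measure_display) (D : measurableType d).
Implicit Types (P : probability D R) (A : set D) (f g : D -> R).

Lemma measure0_integral_eq P A f g : measurable A ->
  P.-integrable A (EFin \o f) -> P.-integrable A (EFin \o g) ->
  (forall x, A x -> f x < g x) ->
  (\int[P]_(x in A) (f x)%:E = \int[P]_(x in A) (g x)%:E)%E -> P A = 0%E.
Proof.
move=> mA fi gi fg fgE.
have mgf : measurable_fun A (fun x => (g x - f x)%:E).
  apply/measurable_EFinP; apply: measurable_funB; apply/measurable_EFinP;
    exact: measurable_int (_ : P.-integrable _ _).
have : (\int[P]_(x in A) `|(g x - f x)%:E| = 0)%E.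
  rewrite (eq_integral (fun x => (g x)%:E - (f x)%:E)%E); last first.
    move=> x /set_mem Ax; rewrite gee0_abs ?EFinB// lee_fin subr_ge0.
    by rewrite ltW// fg.
  rewrite integralB_EFin// -fgE subee//.
  exact: (integrable_fin_num mA fi).
move/(ae_eq_integral_abs P mA mgf) => gf0.
apply: measure_negligible => //; apply: negligibleS gf0 => x Ax /=.
move=> /(_ Ax)[] /eqP; rewrite subr_eq0 => /eqP gfx.
by have := fg x Ax; rewrite gfx ltxx.
Qed.

Lemma ae_rat P (F : rat -> D -> Prop) :
  (forall q, {ae P, forall x, F q x}) -> {ae P, forall x, forall q, F q x}.
Proof.
move=> FP; have FP' n : {ae P, forall x, if unpickle n is Some q then F q x else True}.
  by case: unpickle => [q|]; [exact: FP|exact: aeW].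
by apply: filterS (ae_foralln FP') => x Fx q; have := Fx (pickle q); rewrite pickleK.
Qed.

Lemma ae_le_rat P f g :
  (forall q : rat, P [set x | f x < ratr q <= g x] = 0%E) ->
  (forall q : rat, measurable [set x | f x < ratr q <= g x]) ->
  {ae P, forall x, g x <= f x}.
Proof.
move=> P0 mfg.
have : {ae P, forall x, forall q : rat, ~ (f x < ratr q <= g x)}.
  apply: ae_rat => q; exists [set x | f x < ratr q <= g x]; split => //.
  by move=> x /= /contrapT.
apply: filterS => x fgx; rewrite leNgt; apply/negP => /rat_in_itvoo[q].
rewrite in_itv/= => /andP[fq qg]; apply: (fgx q).
by rewrite fq ltW.
Qed.

(** The event [Y < Y'] is covered by the slices [Y < q <= Y'] with rational [q]. Each slice is an
    intersection of two events of [G], so both versions have the same integral over it, and the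
    strict inequality makes it null. *)
Lemma cond_exp_unique P (G : set_system D) (X Y1 Y2 : D -> R) :
  setI_closed G -> G `<=` measurable ->
  is_cond_exp P G X Y1 -> is_cond_exp P G X Y2 -> {ae P, forall x, Y1 x = Y2 x}.
Proof.
move=> GI Gm.
suff le12 Y Y' : is_cond_exp P G X Y -> is_cond_exp P G X Y' ->
    {ae P, forall x, Y' x <= Y x}.
  move=> h1 h2; apply: filterS2 (le12 _ _ h1 h2) (le12 _ _ h2 h1) => x a b.
  by apply/eqP; rewrite eq_le a b.
move=> [_ Yi GY YE] [_ Y'i GY' Y'E].
have GA (q : rat) : G [set x | Y x < ratr q <= Y' x].
  rewrite (_ : mkset _ = Y @^-1` `]-oo, ratr q[ `&` Y' @^-1` `[ratr q, +oo[).
    by apply: GI; [apply: GY|apply: GY'].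
  by apply/seteqP; split => x /=; rewrite !in_itv/= andbT;
    [case/andP|case=> -> ->].
apply: ae_le_rat => q; last exact: Gm.
have mA := Gm _ (GA q).
apply: (measure0_integral_eq (f := Y) (g := Y')) => //.
- exact: integrableS Yi.
- exact: integrableS Y'i.
- by move=> x /= /andP[]; exact: lt_le_trans.
- by rewrite YE// Y'E.
Qed.

(** The form needed for an estimator that is a function of the statistic only almost surely: the
    version is that function, not the estimator itself. *)
Lemma is_cond_exp_ae P (G : set_system D) (X Y : D -> R) :
  G `<=` measurable -> P.-integrable setT (EFin \o X) ->
  (forall B : set R, measurable B -> G (Y @^-1` B)) ->
  {ae P, forall x, X x = Y x} -> is_cond_exp P G X Y.
Proof.
move=> Gm Xi GY XY.
have mY : measurable_fun setT (EFin \o Y).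
  by apply/measurable_EFinP => _ B mB; rewrite setTI; exact/Gm/GY.
have mX : measurable_fun setT (EFin \o X) := measurable_int P Xi.
have eqA A : measurable A ->
    (\int[P]_(x in A) (Y x)%:E = \int[P]_(x in A) (X x)%:E)%E.
  move=> mA; apply: ae_eq_integral => //; try exact: measurable_funTS.
  by apply: filterS XY => x + _; rewrite /= => ->.
split => //; last by move=> A /Gm; exact: eqA.
apply/integrableP; split => //; case/integrableP: Xi => _; apply: le_lt_trans.
rewrite le_eqVlt; apply/orP; left; apply/eqP.
apply: ae_eq_integral => //; try exact: measurableT_comp.
by apply: filterS XY => x + _; rewrite /= => ->.
Qed.

Lemma sigma_of_measurable (d' : measure_display) (U : measurableType d')
  (T : D -> U) : measurable_fun setT T -> sigma_of T `<=` measurable.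
Proof. by move=> mT _ [C mC <-]; exact: mT. Qed.

(* [phi u] is the infimum of the rationals [q] with [u \in C q], where
   [{h < q} = T^-1 (C q)]. *)
Lemma doob_dynkin (d' : measure_display) (U : measurableType d')
    (T : D -> U) (h : D -> R) :
  (forall B : set R, measurable B -> sigma_of T (h @^-1` B)) ->
  exists2 phi : U -> R, measurable_fun setT phi & forall x, h x = phi (T x).
Proof.
move=> hT.
have /choice[C CP] : forall q : rat, exists C : set U,
    measurable C /\ forall x, C (T x) <-> h x < ratr q.
  move=> q; have [C mC CE] := hT _ (measurable_itv `]-oo, (ratr q : R)[).
  exists C; split => // x; have := congr1 (@^~ x) CE => /= /propeqP.
  by rewrite in_itv/= => CE'; split => [Cx|/CE'[]//]; apply/CE'.
(* The codes [n] enumerate the rationals; [+oo] stands wherever the infimum has nothing to take into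
   account. *)
pose c n u : \bar R := if unpickle n is Some q then
  (if u \in C q then (ratr q)%:E else +oo%E) else +oo%E.
have mc n : measurable_fun setT (c n).
  rewrite /c; case: unpickle => [q|//].
  apply: measurable_fun_ifT => //; apply: (measurable_fun_bool true).
  rewrite setTI (_ : _ @^-1` _ = C q); first by case: (CP q).
  by apply/seteqP; split => u /=; [move/set_mem|move/mem_set].
(* Off the range of [T] the infimum may be infinite, and [fine] turns it into 0. *)
pose phi u := fine (einfs (c ^~ u) 0%N).
exists phi.
  by apply: measurableT_comp => //; exact: measurable_fun_einfs.
move=> x; rewrite /phi; suff -> : einfs (c ^~ (T x)) 0%N = (h x)%:E by [].
apply/eqP; rewrite eq_le; apply/andP; split.
  apply/lee_addgt0Pr => e e0; have : h x < h x + e by rewrite ltrDl.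
  move=> /rat_in_itvoo[q]; rewrite in_itv/= => /andP[hq qh].
  apply: (@le_trans _ _ (ratr q)%:E); last by rewrite lee_fin ltW.
  apply: ereal_inf_lbound; exists (pickle q) => //.
  by rewrite /c pickleK mem_set//; apply/(CP q).2.
apply: le_ereal_inf_tmp => _ [n _ <-]; rewrite /c.
case: unpickle => [q|]; last by rewrite leey.
case: ifPn => [/set_mem/(CP q).2 hq|_]; last by rewrite leey.
by rewrite lee_fin ltW.
Qed.

(** After [n] halvings the widths contribute a factor [(2 ^+ n) ^- 2], while the values of [p] on
    the pieces add up to [p a b]. In the application [J] is the integral of the squared difference
    over a slice and [p] the probability of the slice. *)
Lemma bisection_eq0 (J p : R -> R -> R) (C : R) :
  (forall a b, 0 <= J a b) ->
  (forall a b c, a <= b -> b <= c -> J a c = J a b + J b c) ->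
  (forall a b c, a <= b -> b <= c -> p a c = p a b + p b c) ->
  (forall a b, a <= b -> J a b <= C * (b - a) ^+ 2 * p a b) ->
  forall a b, a <= b -> J a b = 0.
Proof.
move=> J0 JD pD JC a b ab.
have bis n : forall a b, a <= b -> J a b <= C * ((b - a) / 2 ^+ n) ^+ 2 * p a b.
  elim: n => [|n IH] {}a {}b {}ab; first by rewrite expr0 divr1 JC.
  pose m := (a + b) / 2.
  have am : a <= m by rewrite /m; lra.
  have mb : m <= b by rewrite /m; lra.
  rewrite (JD a m b)// (pD a m b)// mulrDr lerD//.
    rewrite (le_trans (IH _ _ am))// (_ : m - a = (b - a) / 2); last first.
      by rewrite /m; field.
    by rewrite (_ : _ / 2 / _ = (b - a) / 2 ^+ n.+1)// exprS invfM mulrA.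
  rewrite (le_trans (IH _ _ mb))// (_ : b - m = (b - a) / 2); last first.
    by rewrite /m; field.
  by rewrite (_ : _ / 2 / _ = (b - a) / 2 ^+ n.+1)// exprS invfM mulrA.
apply/eqP; rewrite eq_le J0 andbT leNgt; apply/negP => J_gt0.
pose K := C * (b - a) ^+ 2 * p a b.
have [n Kn] : exists n : nat, K / J a b < n%:R.
  exists (Num.bound `|K / J a b|).
  exact: le_lt_trans (ler_norm _) (archi_boundP (normr_ge0 _)).
have := bis n a b ab.
have n2 : (n%:R : R) <= (2 ^+ n) ^+ 2.
  by rewrite -!natrX ler_nat -expnM (leq_trans (ltnW (ltn_expl n (ltnSn 1))))// leq_exp2l//; lia.
have e0 : 0 < (2 ^+ n : R) ^+ 2 by rewrite !exprn_gt0.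
rewrite expr_div_n -/K (_ : _ * p a b = K / (2 ^+ n) ^+ 2); last first.
  by rewrite /K mulrA mulrAC.
rewrite ler_pdivlMr// => JK.
move: Kn; rewrite ltr_pdivrMr// ltNge => /negP; apply.
by rewrite (le_trans _ JK)// mulrC ler_pM2l.
Qed.

End MeasureLemmas.

Lemma sqr_dist_le (R : realType) (x a b t : R) : a <= x -> x <= b ->
  (x - a) ^+ 2 <= (b - a) ^+ 2 /\
  (x - t) ^+ 2 <= 2 * (b - a) ^+ 2 + 2 * (a - t) ^+ 2.
Proof.
move=> ax xb; have le1 : (x - a) ^+ 2 <= (b - a) ^+ 2.
  by rewrite lerXn2r ?nnegrE; lra.
by split => //; have := sqr_ge0 (x - a - (a - t)); nra.
Qed.

Lemma sqr_diff_le (R : realType) (x y a : R) :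
  (x - y) ^+ 2 <= 2 * (x - a) ^+ 2 + 2 * (y - a) ^+ 2.
Proof. by have := sqr_ge0 (x - a + (y - a)); nra. Qed.

Section LehmannScheffe.
Context (R : realType) (d : measure_display) (D : measurableType d).
Context (Lam : Type) (Q : Lam -> probability D R).
Context (d' : measure_display) (U : measurableType d') (T : D -> U).

(* Replacing [W] by the complete estimator [Y] on [A = {a <= Y < b}] keeps [W]
   unbiased, so optimality bounds the second moment of [W - a] on [A]. *)
Lemma optimal_second_moment (theta : Lam -> R) (W Y : D -> R) l A a b :
  optimal_unbiased Q theta W -> measurable_fun setT Y ->
  (forall l, (Q l).-integrable setT (EFin \o Y)) -> measurable A ->
  (forall x, A x -> a <= Y x <= b) ->
  (forall l, \int[Q l]_(x in A) (W x)%:E = \int[Q l]_(x in A) (Y x)%:E)%E ->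
  (Q l).-integrable A (EFin \o (fun x => (W x - Y x) ^+ 2)) /\
  \int[Q l]_(x in A) (W x - Y x) ^+ 2 <= 4 * (b - a) ^+ 2 * fine (Q l A).
Proof.
move=> [[mW Wu] Wfin Wopt] mY Yi mA Aab WYE.
pose W' x := if x \in A then Y x else W x.
have mAb : measurable_fun setT (fun x : D => x \in A).
  apply: (measurable_fun_bool true); rewrite setTI (_ : _ @^-1` _ = A)//.
  by apply/seteqP; split => u /=; [move/set_mem|move/mem_set].
have mW' : measurable_fun setT W' by exact: measurable_fun_ifT.
have intA f l' : (Q l').-integrable setT (EFin \o f) ->
    (Q l').-integrable A (EFin \o f) by exact: integrableS.
have split_int (f : D -> \bar R) l' : measurable_fun setT f ->
    (\int[Q l']_x f x = \int[Q l']_(x in A) f x + \int[Q l']_(x in ~` A) f x)%E.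
  move=> mf; rewrite -integral_setU ?setUv//; first exact: measurableC.
  by rewrite disj_set2E setICr.
have W'A x : A x -> W' x = Y x by rewrite /W' => /mem_set ->.
have W'C x : (~` A) x -> W' x = W x.
  by rewrite /W' /= => nA; case: ifPn => // /set_mem.
have mE (f : D -> R) : measurable_fun setT f -> measurable_fun setT (EFin \o f).
  by move=> ?; exact/measurable_EFinP.
have W'u : unbiased Q theta W'.
  split=> // l'; have [Wi WE] := Wu l'; split.
    apply: (@le_integrable _ _ _ (Q l') _ measurableT _
      (fun x => `|W x|%:E + `|Y x|%:E)%E) => //; first exact: mE.
      move=> x _; rewrite /= lee_fin [leRHS]ger0_norm ?addr_ge0//.
      by rewrite /W'; case: ifP => _; rewrite ?lerDl ?lerDr.
    apply: integrableD => //; [exact: (integrable_norm Wi)|].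
    exact: (integrable_norm (Yi l')).
  rewrite -WE !split_int//; try exact: mE.
  congr (_ + _)%E; last by apply: eq_integral => x /set_mem/W'C ->.
  by rewrite WYE; apply: eq_integral => x /set_mem/W'A ->.
have {Wopt} := Wopt _ W'u l; rewrite /var_around => Wopt.
have := Wfin l; rewrite /var_around => W2fin.
set t := theta l in Wopt W2fin.
have m2 (f : D -> R) : measurable_fun setT f -> measurable_fun setT (fun x => ((f x - t) ^+ 2)%:E).
  by move=> mf; apply: mE; apply: measurable_funX; exact: measurable_funB.
have ge02 (f : D -> R) x : (0 <= ((f x - t) ^+ 2)%:E)%E by rewrite lee_fin sqr_ge0.
have W2i : (Q l).-integrable setT (fun x => ((W x - t) ^+ 2)%:E).
  apply/integrableP; split; first exact: m2.
  by under eq_integral do rewrite gee0_abs//.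
have mYA : measurable_fun A Y by exact: measurable_funTS.
have Y2i : (Q l).-integrable A (EFin \o (fun x => (Y x - t) ^+ 2)).
  apply: (@le_integrable _ _ _ (Q l) _ mA _
      (EFin \o cst (2 * (b - a) ^+ 2 + 2 * (a - t) ^+ 2))).
  - by apply: measurable_funTS; exact: m2.
  - move=> x /Aab /andP[aY Yb]; rewrite /= lee_fin ger0_norm ?sqr_ge0//.
    rewrite (le_trans _ (ler_norm _))//.
    exact: (sqr_dist_le t aY Yb).2.
  - exact: finite_measure_integrable_cst.
have {}W2i := integrableS measurableT mA (@subsetT _ A) W2i.
(* Off [A] the competitor [W'] is [W]; that part of the variance is finite and cancels. *)
have W2Y2 : \int[Q l]_(x in A) (W x - t) ^+ 2 <= \int[Q l]_(x in A) (Y x - t) ^+ 2.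
  rewrite fine_le ?(integrable_fin_num mA _)//.
  move: Wopt; rewrite !split_int; [|exact: m2..].
  rewrite [X in (_ <= _ + X)%E -> _](_ : _ =
      \int[Q l]_(x in ~` A) ((W x - t) ^+ 2)%:E)%E; last first.
    by apply: eq_integral => x /set_mem/W'C ->.
  rewrite [X in (_ <= X + _)%E -> _](_ : _ =
      \int[Q l]_(x in A) ((Y x - t) ^+ 2)%:E)%E; last first.
    by apply: eq_integral => x /set_mem/W'A ->.
  rewrite leeD2rE// ge0_fin_numE ?integral_ge0//.
  apply: le_lt_trans W2fin; rewrite split_int; last exact: m2.
  by rewrite leeDr// integral_ge0.
(* Moving the centre of the second moment from [t] to [a] changes it by terms in the integral of [f]
   and the measure of [A] only. These agree for [W] and [Y], so the inequality survives the move. *)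
have shift (f : D -> R) : (Q l).-integrable A (EFin \o f) ->
    (Q l).-integrable A (EFin \o (fun x => (f x - t) ^+ 2)) ->
    (Q l).-integrable A (EFin \o (fun x => (f x - a) ^+ 2)) /\
    \int[Q l]_(x in A) (f x - a) ^+ 2 =
    \int[Q l]_(x in A) (f x - t) ^+ 2 + 2 * (t - a) * \int[Q l]_(x in A) f x +
    (a ^+ 2 - t ^+ 2) * fine (Q l A).
  move=> fi f2i.
  have E x : (f x - a) ^+ 2 = (f x - t) ^+ 2 + 2 * (t - a) * f x + (a ^+ 2 - t ^+ 2).
    by ring.
  have i1 : (Q l).-integrable A (EFin \o (fun x => 2 * (t - a) * f x)).
    by apply: eq_integrable (integrableZl mA (2 * (t - a)) fi) => // x _.
  have i2 : (Q l).-integrable A (EFin \o (fun x => (f x - t) ^+ 2 + 2 * (t - a) * f x)).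
    by apply: eq_integrable (integrableD mA f2i i1) => // x _.
  have i3 : (Q l).-integrable A (EFin \o cst (a ^+ 2 - t ^+ 2)).
    exact: finite_measure_integrable_cst.
  split.
    by apply: eq_integrable (integrableD mA i2 i3) => // x _; rewrite /= E.
  under eq_Rintegral do rewrite E.
  by rewrite RintegralD// RintegralD// RintegralZl// Rintegral_cst.
have [Wai WaE] := shift W (intA _ _ (Wu l).1) W2i.
have [Yai YaE] := shift Y (intA _ _ (Yi l)) Y2i.
have Wa_le : \int[Q l]_(x in A) (W x - a) ^+ 2 <= (b - a) ^+ 2 * fine (Q l A).
  apply: (@le_trans _ _ (\int[Q l]_(x in A) (Y x - a) ^+ 2)).
    by rewrite WaE YaE !lerD2r /Rintegral WYE lerD2r; exact: W2Y2.
  rewrite -Rintegral_cst//; apply: le_Rintegral => //.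
    exact: finite_measure_integrable_cst.
  by move=> x /Aab /andP[aY Yb]; exact: (sqr_dist_le t aY Yb).1.
have Ya_le : \int[Q l]_(x in A) (Y x - a) ^+ 2 <= (b - a) ^+ 2 * fine (Q l A).
  rewrite -Rintegral_cst//; apply: le_Rintegral => //.
    exact: finite_measure_integrable_cst.
  by move=> x /Aab /andP[aY Yb]; exact: (sqr_dist_le t aY Yb).1.
have i2 (f : D -> R) : (Q l).-integrable A (EFin \o f) ->
    (Q l).-integrable A (EFin \o (fun x => 2 * f x)).
  by move=> fi; apply: eq_integrable (integrableZl mA 2 fi) => // x _.
have Si : (Q l).-integrable A
    (EFin \o (fun x => 2 * (W x - a) ^+ 2 + 2 * (Y x - a) ^+ 2)).
  by apply: eq_integrable (integrableD mA (i2 _ Wai) (i2 _ Yai)) => // x _.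
(* The constant 4 is [2 + 2]: both moments about [a] are at most [(b - a) ^+ 2] times the measure of
   [A]. *)
have WY_le x : (W x - Y x) ^+ 2 <= 2 * (W x - a) ^+ 2 + 2 * (Y x - a) ^+ 2.
  exact: sqr_diff_le.
have WYi : (Q l).-integrable A (EFin \o (fun x => (W x - Y x) ^+ 2)).
  apply: le_integrable Si => //.
    apply: measurable_funTS; apply: mE; apply: measurable_funX.
    exact: measurable_funB.
  move=> x _; rewrite /= lee_fin ger0_norm ?sqr_ge0//.
  exact: le_trans (WY_le x) (ler_norm _).
split => //; apply: (le_trans (le_Rintegral mA WYi Si (fun x _ => WY_le x))).
rewrite RintegralD ?RintegralZl//; [|exact: i2..].
rewrite (_ : 4 * _ * _ = 2 * ((b - a) ^+ 2 * fine (Q l A)) +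
  2 * ((b - a) ^+ 2 * fine (Q l A))); last by ring.
by rewrite lerD// ler_pM2l.
Qed.

(** The conditional expectation of [W] and the function [Y] of [T] that represents [W0] are both
    unbiased, so completeness identifies them. Hence [W] and [Y] have equal integrals over the
    slices of [Y], where optimality of [W] bounds their distance. *)
Lemma optimal_unbiased_complete (theta : Lam -> R) (W W0 : D -> R) :
  measurable_fun setT T -> sufficient_stat Q T -> complete_stat Q T ->
  optimal_unbiased Q theta W -> unbiased Q theta W0 -> determines Q T W0 ->
  forall l, {ae Q l, forall x, W x = W0 x}.
Proof.
move=> mT suff_T compl_T Wopt [mW0 W0u] [g mg W0g] l.
have [[mW Wu] _ _] := Wopt.
have mY : measurable_fun setT (g \o T) by exact: measurableT_comp.
pose Y := g \o T.
have Yint l' : (Q l').-integrable setT (EFin \o Y) /\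
    (\int[Q l']_x (Y x)%:E = (theta l')%:E)%E.
  have [W0i W0E] := W0u l'.
  have [] := @is_cond_exp_ae _ _ _ (Q l') (sigma_of T) W0 Y
    (sigma_of_measurable mT) W0i _ (W0g l').
    move=> B mB; exists (g @^-1` B); last by rewrite setTI.
    by rewrite -[X in measurable X]setTI; exact: mg.
  move=> _ Yi _ YE; split => //; rewrite YE//.
  by exists setT => //; rewrite setTI preimage_setT.
have [h' h'P] := suff_T W (fun l => (Wu l).1).
have [phi mphi h'E] : exists2 phi : U -> R, measurable_fun setT phi &
    forall x, h' x = phi (T x).
  by apply: doob_dynkin; case: (h'P l).
have phig l' : {ae Q l', forall x, phi (T x) - g (T x) = 0}.
  apply: (compl_T (phi \- g)) => [|l'']; first exact: measurable_funB.
  have [_ h'i _ h'W] := h'P l''; have [Yi YE] := Yint l''.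
  have phii : (Q l'').-integrable setT (EFin \o (phi \o T)).
    by rewrite (_ : phi \o T = h')//; apply/funext => x; rewrite /= h'E.
  split.
    by apply: eq_integrable (integrableB _ phii Yi) => //.
  transitivity (\int[Q l'']_x ((phi (T x))%:E - (Y x)%:E))%E => //.
  rewrite integralB_EFin// YE.
  rewrite (_ : (\int[Q l'']_x _)%E = (theta l'')%:E) ?subee//.
  rewrite -(Wu l'').2 -h'W; last by exists setT => //; rewrite setTI preimage_setT.
  by apply: eq_integral => x _; rewrite h'E.
have WYE A : sigma_of T A -> forall l',
    (\int[Q l']_(x in A) (W x)%:E = \int[Q l']_(x in A) (Y x)%:E)%E.
  move=> sA l'; have [_ h'i _ h'W] := h'P l'; rewrite -h'W//.
  have mA := sigma_of_measurable mT sA.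
  apply: ae_eq_integral => //.
  - by apply: measurable_funTS; exact: measurable_int h'i.
  - by apply: measurable_funTS; exact: (measurable_int _ (Yint l').1).
  - apply: filterS (phig l') => x /eqP; rewrite subr_eq0 => /eqP phix _.
    by rewrite /= h'E phix.
(* Half-open intervals, so that adjacent slices are disjoint and fill the slice of the union. *)
pose A a b := Y @^-1` `[a, b[.
have sA a b : sigma_of T (A a b).
  exists (g @^-1` `[a, b[); last by rewrite setTI.
  by rewrite -[X in measurable X]setTI; exact: mg.
have mA a b : measurable (A a b) := sigma_of_measurable mT (sA a b).
have Aab a b x : A a b x -> a <= Y x <= b.
  by rewrite /A /= in_itv/= => /andP[-> /ltW].
have AU a b c : a <= b -> b <= c -> A a c = A a b `|` A b c.
  move=> ab bc; rewrite /A; apply/seteqP; split => x /=; rewrite !in_itv/=.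
    by move=> /andP[-> ->]; case: (ltP (Y x) b); [left|right].
  move=> [] /andP[Y1 Y2]; rewrite ?Y1 ?Y2 ?andbT/=.
    exact: lt_le_trans bc.
  exact: le_trans ab _.
have Adisj a b c : [disjoint A a b & A b c].
  rewrite disj_set2E; apply/eqP/seteqP; split => x //= [].
  by rewrite /A/= !in_itv/= => /andP[_ Yb] /andP[+ _]; rewrite leNgt Yb.
have smom a b := optimal_second_moment l Wopt mY (fun l => (Yint l).1)
  (mA a b) (@Aab a b) (WYE _ (sA a b)).
have J0 a b : a <= b -> \int[Q l]_(x in A a b) (W x - Y x) ^+ 2 = 0.
  apply: (@bisection_eq0 R (fun a b => \int[Q l]_(x in A a b) (W x - Y x) ^+ 2)
    (fun a b => fine (Q l (A a b))) 4).
  - by move=> {}a {}b; apply: Rintegral_ge0 => x _; exact: sqr_ge0.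
  - move=> {}a {}b c ab bc; rewrite (AU a b c)// Rintegral_setU// -AU//.
    by have [] := smom a c.
  - move=> {}a {}b c ab bc; rewrite (AU a b c)// measureU//; last first.
      by apply/eqP; rewrite -disj_set2E.
    by rewrite fineD// fin_num_measure.
  - by move=> {}a {}b ab; have [] := smom a b.
have aeA a b : a <= b -> {ae Q l, forall x, A a b x -> W x = Y x}.
  move=> ab; have [Ji _] := smom a b.
  have /(ae_eq_integral_abs (Q l) (mA a b) (measurable_int _ Ji)) :
      (\int[Q l]_(x in A a b) `|((W x - Y x) ^+ 2)%:E| = 0)%E.
    rewrite (eq_integral (fun x => ((W x - Y x) ^+ 2)%:E)); last first.
      by move=> x _; rewrite gee0_abs// lee_fin sqr_ge0.
    by rewrite -[LHS]fineK ?(integrable_fin_num _ Ji)// -/(Rintegral _ _ _) J0.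
  apply: filterS => x h /h [] /eqP; rewrite sqrf_eq0 subr_eq0 => /eqP.
  exact.
(* The slices from [- n%:R] to [n%:R] exhaust the space, as [Y] is finite everywhere. *)
have : {ae Q l, forall x, forall n : nat, A (- n%:R) n%:R x -> W x = Y x}.
  by apply: ae_foralln => n; apply: aeA; rewrite ge0_cp// ler0n.
apply: filterS2 (W0g l) => x W0x WY; rewrite W0x.
apply: (WY (Num.bound `|Y x|)); rewrite /A/= in_itv/=.
have := archi_boundP (normr_ge0 (Y x)).
by rewrite -/(Y x) ltr_norml => /andP[/ltW -> ->].
Qed.

End LehmannScheffe.

(** * Placement of the rewards and path weights *)

Section Placement.
Context (R : realType) (N n : nat).
Notation pair := ('I_N * 'I_N)%type.
Implicit Types X : 'I_n -> seq 'I_N.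

(** Each transition keeps the path and the time at which it was made, so that its reward can be
    traced through the regrouping by [labels]. *)
Definition slots X : seq (pair * ('I_n * nat)) :=
  flatten [seq zip (steps (X k)) [seq (k, t) | t <- iota 0 (size (X k)).-1]
          | k <- enum 'I_n].

Definition sorted_slots X : seq (pair * ('I_n * nat)) :=
  flatten [seq [seq p <- slots X | p.1 == e] | e <- enum {: pair}].

Definition places X : seq ('I_n * nat) := unzip2 (sorted_slots X).

Lemma size_steps_iota X k :
  size (steps (X k)) = size [seq (k, t) | t <- iota 0 (size (X k)).-1].
Proof.
rewrite size_map size_iota /steps size_zip size_behead.
by case: (X k) => //= x xs; rewrite (minn_idPr _).
Qed.

Lemma unzip1_slots X : unzip1 (slots X) = flatten [seq steps (X k) | k <- enum 'I_n].
Proof.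
rewrite /slots /unzip1 map_flatten -map_comp; congr flatten; apply: eq_map => k.
by rewrite /= -/(unzip1 _) unzip1_zip// size_steps_iota.
Qed.

Lemma unzip2_slots X :
  unzip2 (slots X) = [seq (k, t) | k <- enum 'I_n, t <- iota 0 (size (X k)).-1].
Proof.
rewrite /slots /unzip2 map_flatten -map_comp; congr flatten; apply: eq_map => k.
by rewrite /= -/(unzip2 _) unzip2_zip// size_steps_iota.
Qed.

Lemma count_slots X e : count (fun p => p.1 == e) (slots X) = step_counts X e.
Proof.
rewrite ffunE -(count_map fst (pred1 e)) -/(unzip1 _) unzip1_slots.
by rewrite count_flatten -map_comp sumnE big_map big_enum.
Qed.

Lemma perm_sorted_slots X : perm_eq (sorted_slots X) (slots X).
Proof.
apply/permP => a; rewrite count_flatten -map_comp sumnE big_map big_enum/=.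
under eq_bigr do rewrite count_filter.
elim: (slots X) => [|p l IH] /=; first by rewrite big1.
rewrite big_split/= {}IH; congr (_ + _)%N; rewrite (bigD1 p.1)//= eqxx andbT.
by rewrite big1 ?addn0// => e /negbTE pe; rewrite eq_sym pe andbF.
Qed.

Lemma unzip1_sorted_slots X : unzip1 (sorted_slots X) = labels (step_counts X).
Proof.
rewrite /sorted_slots /unzip1 map_flatten -map_comp; congr flatten.
apply: eq_map => e /=; rewrite -count_slots.
by elim: (slots X) => //= p l IH; case: eqP => //= pe; rewrite IH pe.
Qed.

Lemma size_labels X : size (labels (step_counts X)) = size (sorted_slots X).
Proof. by rewrite -unzip1_sorted_slots size_map. Qed.

Lemma size_places X : size (places X) = size (sorted_slots X).
Proof. by rewrite size_map. Qed.

(** With [mem_places] this gives a bijection between positions in the tuple of observed rewards and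
    pairs of a path and a transition time: a box in one indexing is a box in the other. *)
Lemma uniq_places X : uniq (places X).
Proof.
rewrite (perm_uniq (perm_map snd (perm_sorted_slots X))) -/(unzip2 _) unzip2_slots.
apply: allpairs_uniq_dep; first exact: enum_uniq.
  by move=> k _; exact: iota_uniq.
by move=> [k t] [k' t'] _ _ /= [-> ->].
Qed.

Lemma mem_places X k t : ((k, t) \in places X) = (t < (size (X k)).-1)%N.
Proof.
rewrite (perm_mem (perm_map snd (perm_sorted_slots X))) -/(unzip2 _) unzip2_slots.
apply/allpairsPdep/idP => [[k' [t' [_ + [-> ->]]]]|t_lt].
  by rewrite mem_iota.
by exists k, t; rewrite mem_enum mem_iota.
Qed.

Lemma zip_map_snd (A B C : Type) (f : B -> C) (s : seq A) (t : seq B) :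
  zip s (map f t) = [seq (p.1, f p.2) | p <- zip s t].
Proof. by elim: s t => [|x s IH] [|y t] //=; rewrite IH. Qed.

Section Observation.
Context (d : measure_display) (Omega : measurableType d) (Z : sample R N n Omega).

Definition placed_rewards X w : seq R := [seq rewards Z p.1 p.2 w | p <- places X].

Lemma labelled_rewards_slots w : labelled_rewards Z w =
  [seq (p.1, rewards Z p.2.1 p.2.2 w) | p <- slots (fun k => states Z k w)].
Proof.
rewrite /labelled_rewards /slots map_flatten -map_comp; congr flatten.
apply: eq_map => k /=; rewrite !zip_map_snd -map_comp.
exact: eq_map.
Qed.

Lemma observed_rewards_placed w :
  observed_rewards Z w = placed_rewards (fun k => states Z k w) w.
Proof.
rewrite /observed_rewards labelled_rewards_slots /placed_rewards /places /unzip2.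
rewrite -[RHS]map_comp /sorted_slots [RHS]map_flatten -[in RHS]map_comp.
by congr flatten; apply: eq_map => e; rewrite /= filter_map -map_comp.
Qed.

Lemma sum_total_reward w e :
  let m := mu Z w in
  total_reward e (robs_of Z m w) = \sum_(er <- labelled_rewards Z w | er.1 == e) er.2.
Proof.
move=> m; pose X k := states Z k w.
have mX : m = step_counts X by [].
rewrite /total_reward labelled_rewards_slots big_map/=.
rewrite -(perm_big _ (perm_sorted_slots X))/=.
transitivity (\sum_(q <- zip (unzip1 (sorted_slots X)) (placed_rewards X w) | q.1 == e) q.2).
  rewrite unzip1_sorted_slots.
  have sz : size (labels (step_counts X)) = size (placed_rewards X w).
    by rewrite size_labels size_map size_places.
  rewrite mX; case: (posnP (size (labels (step_counts X)))) => [s0|s0].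
    rewrite [LHS]big1; last by move=> k; have := ltn_ord k; rewrite {2}s0.
    by rewrite (size0nil s0); case: placed_rewards => *; rewrite big_nil.
  have [e0 _] : exists e0 : pair, True by case: (labels _) s0 => // e0 ? _; exists e0.
  rewrite (big_nth (e0, 0)) size_zip -sz minnn big_mkord; apply: eq_big => k.
    by rewrite nth_zip// /label (tnth_nth e0).
  move=> _; rewrite nth_zip//= tnth_mktuple.
  by rewrite observed_rewards_placed.
rewrite /placed_rewards /places /unzip1 /unzip2 -map_comp.
elim: (sorted_slots X) => [|p l IH] /=; first by rewrite !big_nil.
by rewrite !big_cons/= IH.
Qed.

(** The variant of [robs_of] with the places computed from fixed paths [X]: each entry is then a
    fixed reward variable (or the default), hence measurable. *)
Definition robs_at X (m : counts N) (w : Omega) : robs R m :=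
  [tuple nth 0 (placed_rewards X w) k | k < size (labels m)].

Lemma robs_of_at X m w : (forall k, states Z k w = X k) ->
  robs_of Z m w = robs_at X m w.
Proof.
move=> wX; apply: eq_mktuple => k; rewrite observed_rewards_placed.
by have -> : (fun k => states Z k w) = X by exact/funext.
Qed.

Lemma measurable_robs_at X m : measurable_fun setT (robs_at X m).
Proof.
apply/measurable_fun_tnthP => k.
rewrite (_ : _ \o _ = fun w => nth 0 (placed_rewards X w) k); last first.
  by apply/funext => w; rewrite /= tnth_mktuple.
rewrite /placed_rewards; elim: (places X) (nat_of_ord k) => [|p l IH] [|i] //=.
exact: measurable_rewards.
Qed.

End Observation.
End Placement.

Section PathLaw.
Context (R : realType) (N : nat) (edge : rel 'I_N) (start : {set 'I_N}).
Context (M : reward_model R N) (th : parameter M).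
Notation pair := ('I_N * 'I_N)%type.

Fixpoint weight_from (i : 'I_N) (xs : seq 'I_N) : R :=
  if xs is j :: xs' then trans th i j * weight_from j xs'
  else (terminal edge i)%:R.

Definition path_weight (xs : seq 'I_N) : R :=
  if xs is i :: xs' then init th 0 i * weight_from i xs' else 0.

(** The offset [m] carries the induction, because the recursion shifts the times of the reward
    conditions. *)
Lemma path_law_fromE i xs (B : nat -> set R) m :
  (path_law_from edge th i xs (fun t => B (m + t)%N) = (weight_from i xs)%:E *
   \prod_(p <- zip (steps (i :: xs)) (iota m (size xs)))
     rlaw (rparam th) p.1 (B p.2))%E.
Proof.
elim: xs i m => [|j xs IH] i m /=.
  by rewrite big_nil mule1; case: terminal.
rewrite big_cons/= addn0 EFinM.
rewrite (_ : (fun t => B (m + t.+1)%N) = (fun t => B (m.+1 + t)%N)); last first.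
  by apply/funext => t; rewrite addSnnS.
by rewrite IH -!muleA; congr (_ * _)%E; rewrite muleCA.
Qed.

Lemma path_lawE xs (B : nat -> set R) :
  (path_law edge th xs B = (path_weight xs)%:E *
   \prod_(p <- zip (steps xs) (iota 0 (size xs).-1))
     rlaw (rparam th) p.1 (B p.2))%E.
Proof.
case: xs => [|i xs] /=; first by rewrite mul0e.
by rewrite (path_law_fromE i xs B 0) EFinM muleA.
Qed.

(** Separates the probability of the paths from the reward laws, and lists the latter in the order
    used by [Q]. *)
Lemma prod_path_law n (X : 'I_n -> seq 'I_N) (B : 'I_n -> nat -> set R) :
  (\prod_k path_law edge th (X k) (B k) = (\prod_k path_weight (X k))%:E *
   \prod_(p <- sorted_slots X) rlaw (rparam th) p.1 (B p.2.1 p.2.2))%E.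
Proof.
rewrite (eq_bigr _ (fun k _ => path_lawE (X k) (B k))).
rewrite big_split/= prodEFin; congr (_ * _)%E.
rewrite (perm_big _ (perm_sorted_slots X))/= big_flatten big_map big_enum/=.
by apply: eq_bigr => k _; rewrite zip_map_snd big_map.
Qed.

Hypothesis th_valid : valid start edge th.

Lemma trans_ge0 i j : 0 <= trans th i j.
Proof. by case: th_valid => _ [] + _ _ _ _; exact. Qed.

Lemma init_ge0 i : 0 <= init th 0 i.
Proof. by case: th_valid => -[] + _ _ _ _ _; exact. Qed.

Lemma weight_from_ge0 i xs : 0 <= weight_from i xs.
Proof.
by elim: xs i => [|j xs IH] i /=; [rewrite ler0n|rewrite mulr_ge0 ?trans_ge0].
Qed.

Lemma path_weight_ge0 xs : 0 <= path_weight xs.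
Proof. by case: xs => //= i xs; rewrite mulr_ge0 ?init_ge0 ?weight_from_ge0. Qed.

Lemma weight_from_eq0 i xs : ~~ (path edge i xs && terminal edge (last i xs)) ->
  weight_from i xs = 0.
Proof.
case: th_valid => _ [trans0 _] _ transP _.
elim: xs i => [|j xs IH] i /=; first by move/negbTE ->.
case: (boolP (edge i j)) => [_ /= /IH ->|]; first by rewrite mulr0.
rewrite -transP -leNgt => tij _; suff -> : trans th i j = 0 by rewrite mul0r.
by apply/eqP; rewrite eq_le tij trans0.
Qed.

Lemma path_weight_eq0 (s : 'I_N) xs :
  ~~ complete_path start edge s xs -> path_weight xs = 0.
Proof.
case: xs => //= i xs; rewrite /complete_path/=.
case: (boolP (i \in start)) => [_ /= /weight_from_eq0 ->|]; first by rewrite mulr0.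
case: th_valid => _ _ startP _ _; rewrite -startP -leNgt => ii _.
suff -> : init th 0 i = 0 by rewrite mul0r.
by apply/eqP; rewrite eq_le ii init_ge0.
Qed.

End PathLaw.

(** * Law of the sample *)

Section MeasureTransport.
Context (R : realType).

Lemma ge0_integral_mrestr d (D : measurableType d) (P : {measure set D -> \bar R})
    (S : set D) (mS : measurable S) (f : D -> \bar R) :
  measurable_fun setT f -> (forall x, 0 <= f x)%E ->
  (\int[mrestr P mS]_x f x = \int[P]_(x in S) f x)%E.
Proof.
move=> mf f0; have mSC := measurableC mS.
rewrite -(setUv S) integral_setU//; last 2 first.
- by rewrite setUv.
- by rewrite disj_set2E setICr.
rewrite [X in (_ + X)%E]null_set_integral//; last 2 first.
- exact: measurable_funTS.
- by rewrite /= /mrestr setICl measure0.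
rewrite adde0; apply: eq_measure_integral => A mA AS.
by rewrite /= /mrestr setIidl.
Qed.

Definition pushforward_measure d d' (D : measurableType d) (D' : measurableType d')
    (P : {measure set D -> \bar R}) (f : D -> D') (mf : measurable_fun setT f) :
    {measure set D' -> \bar R} :=
  measure_function_pushforward__canonical__measure_function_Measure P mf.

(* Boxes are a pi-system generating the measurable sets of tuples. *)
Lemma tuple_measure_unique (n : nat)
    (m1 m2 : {measure set (n.-tuple R) -> \bar R}) :
  (m1 setT < +oo)%E ->
  (forall B : 'I_n -> set R, (forall k, measurable (B k)) ->
    m1 [set y | forall k, B k (tnth y k)] =
    m2 [set y | forall k, B k (tnth y k)]) ->
  forall A, measurable A -> m1 A = m2 A.
Proof.
move=> m1oo m12 A mA.
pose G : set (set (n.-tuple R)) := [set A | exists B : 'I_n -> set R,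
  (forall k, measurable (B k)) /\ A = [set y | forall k, B k (tnth y k)]].
have GT : G setT.
  by exists (fun=> setT); split => //; apply/seteqP; split.
apply: (g_sigma_algebra_measure_unique G _ (fun=> setT)) => //.
- move=> _ [B [mB ->]].
  rewrite (_ : mkset _ = \bigcap_(k in [set: 'I_n]) (fun y => tnth y k) @^-1` B k).
    apply: fin_bigcap_measurable => // k _.
    by rewrite -[X in measurable X]setTI; exact: measurable_tnth.
  by apply/seteqP; split => y /= yB k; [move=> _|]; exact: (yB k).
- by rewrite bigcup_const//; exists 0%N.
- move=> _ _ [B [mB ->]] [B' [mB' ->]]; exists (fun k => B k `&` B' k); split.
    by move=> k; exact: measurableI.
  apply/seteqP; split => y /= => [[yB yB'] k|yBB]; first by split.
  by split => k; have [] := yBB k.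
- by move=> _ [B [mB ->]]; exact: m12.
apply: smallest_sub mA; first exact: smallest_sigma_algebra.
rewrite -bigcup_seq; apply: bigcup_sub => k _ _ [B mB <-].
apply: sub_sigma_algebra; exists (fun j => if j == k then B else setT); split.
  by move=> j; case: ifP.
rewrite setTI; apply/seteqP; split => y /= => [yB j|/(_ k)]; last by rewrite eqxx.
by case: eqP => // ->.
Qed.

End MeasureTransport.

Section SampleLaw.
Context (R : realType) (N n : nat) (start : {set 'I_N}) (edge : rel 'I_N).
Context (M : reward_model R N).
Context (Q : forall m : counts N, rpar M -> probability (robs R m) R).
Context (d : measure_display) (Omega : measurableType d).
Context (P : parameter M -> probability Omega R) (Z : sample R N n Omega).
Implicit Types X : 'I_n -> seq 'I_N.

Definition states_event X : set Omega := [set w | forall k, states Z k w = X k].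

Lemma measurable_states_event X : measurable (states_event X).
Proof.
rewrite (_ : states_event X =
    \bigcap_(k in [set: 'I_n]) [set w | states Z k w = X k]).
  apply: fin_bigcap_measurable => // k _; exact: measurable_states.
by apply/seteqP; split => w /= wX k; [move=> _|]; exact: (wX k).
Qed.

(** A countable partition into events with constant paths. As [pickle_inv] decodes only genuine
    codes, every choice of paths has a single index and the classes are disjoint. *)
Definition states_class (i : nat) : set Omega :=
  if pickle_inv i is Some X then states_event (X : {ffun 'I_n -> seq 'I_N}) else set0.

Lemma measurable_states_class i : measurable (states_class i).
Proof. by rewrite /states_class; case: pickle_inv => // X; exact: measurable_states_event. Qed.

Lemma states_class_pickle w :
  states_class (pickle [ffun k => states Z k w]) w.
Proof. by rewrite /states_class pickleK_inv => k; rewrite ffunE. Qed.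

Lemma bigcup_states_class : \bigcup_i states_class i = setT.
Proof.
rewrite -subTset => w _; exists (pickle [ffun k => states Z k w]) => //.
exact: states_class_pickle.
Qed.

Lemma trivIset_states_class : trivIset setT states_class.
Proof.
apply/trivIsetP => i j _ _ ij; apply/seteqP; split => // w [].
rewrite /states_class.
case Xi: (pickle_inv i) => [X|//]; case Xj: (pickle_inv j) => [Y|//] wX wY.
have XY : X = Y by apply/ffunP => k; rewrite -wX wY.
have := pickle_invK (T := {ffun 'I_n -> seq 'I_N}) i; rewrite Xi /= => pX.
have := pickle_invK (T := {ffun 'I_n -> seq 'I_N}) j; rewrite Xj /= => pY.
by move: ij; rewrite -pX -pY XY eqxx.
Qed.

Lemma ae_states (mu : {measure set Omega -> \bar R}) (F : Omega -> Prop) :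
  (forall X, mu.-negligible [set w | states_event X w /\ ~ F w]) ->
  {ae mu, forall w, F w}.
Proof.
move=> FX; have : mu.-negligible (\bigcup_i (states_class i `&` [set w | ~ F w])).
  apply: negligible_bigcup => i; rewrite /states_class; case: pickle_inv => [X|].
    exact: FX.
  by rewrite set0I; exact: negligible_set0.
apply: negligibleS => w /= nF; exists (pickle [ffun k => states Z k w]) => //.
by split => //; exact: states_class_pickle.
Qed.

Lemma measurable_fun_states d' (U : measurableType d') (f : Omega -> U) :
  (forall X, exists2 g : Omega -> U, measurable_fun setT g &
    forall w, states_event X w -> f w = g w) -> measurable_fun setT f.
Proof.
move=> fX _ B mB; rewrite setTI.
rewrite (_ : f @^-1` B = \bigcup_i (states_class i `&` f @^-1` B)); last first.
  by rewrite -setI_bigcupl bigcup_states_class setTI.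
apply: bigcupT_measurable => i; rewrite /states_class.
case: pickle_inv => [X|]; last by rewrite set0I.
have [g mg fg] := fX X.
rewrite (_ : _ `&` _ = states_event X `&` (setT `&` g @^-1` B)).
  apply: measurableI; [exact: measurable_states_event|exact: mg].
by rewrite setTI; apply/seteqP; split => w [wX]; rewrite /= fg.
Qed.

Lemma le_integral_states (mu : {measure set Omega -> \bar R}) (f g : Omega -> \bar R) :
  measurable_fun setT f -> measurable_fun setT g ->
  (forall w, 0 <= f w)%E -> (forall w, 0 <= g w)%E ->
  (forall X, \int[mu]_(w in states_event X) f w <=
    \int[mu]_(w in states_event X) g w)%E ->
  (\int[mu]_w f w <= \int[mu]_w g w)%E.
Proof.
move=> mf mg f0 g0 fg; rewrite -bigcup_states_class.
rewrite !ge0_integral_bigcup//; try exact: measurable_states_class;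
  try exact: trivIset_states_class; try (by rewrite bigcup_states_class).
apply: lee_nneseries => [i _ _|i _]; first exact: integral_ge0.
rewrite /states_class; case: pickle_inv => [X|]; first exact: fg.
by rewrite !integral_set0.
Qed.

Hypothesis indep : independent_rewards Q.
Hypothesis iid : iid_sample start edge P Z.
Context (th : parameter M).
Hypothesis th_valid : valid start edge th.

Definition sample_weight X : R := \prod_k path_weight edge th (X k).

Lemma sample_weight_ge0 X : 0 <= sample_weight X.
Proof. by apply: prodr_ge0 => k _; exact: (path_weight_ge0 th_valid). Qed.

Lemma robs_at_box_law X (m := step_counts X) (B : 'I_(size (labels m)) -> set R) :
  (forall j, measurable (B j)) ->
  (P th (states_event X `&`
      robs_at Z X m @^-1` [set y | forall j, B j (tnth y j)]) =
   (sample_weight X)%:E * Q m (rparam th) [set y | forall j, B j (tnth y j)])%E.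
Proof.
move=> mB; rewrite indep//.
(* The side of the box at position [j] is moved to the path and time of the [j]-th place; all other
   times are left unconstrained. *)
pose B' k t : set R :=
  if insub (index (k, t) (places X)) is Some j then B j else setT.
have mB' k t : measurable (B' k t) by rewrite /B'; case: insub.
have sz : size (places X) = size (labels m) by rewrite size_places -size_labels.
rewrite (_ : _ `&` _ = [set w | forall k, states Z k w = X k /\
    forall t, (t.+1 < size (X k))%N -> B' k t (rewards Z k t w)]); last first.
  apply/seteqP; split => w /=.
    move=> [wX wB] k; split => // t t_lt; rewrite /B'.
    case: insubP => // j j_lt jE; have := wB j; rewrite tnth_mktuple.
    have kt : (k, t) \in places X by rewrite mem_places; lia.
    by rewrite (nth_map (k, t)) ?sz// jE nth_index.
  move=> wX; split => [k|j]; first by case: (wX k).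
  rewrite tnth_mktuple.
  have j_lt : (j < size (places X))%N by rewrite sz.
  have [p0 _] : exists p0 : 'I_n * nat, True.
    by case: (places X) j_lt => // p ? _; exists p.
  rewrite (nth_map p0)//; case pj: (nth p0 (places X) j) => [k t].
  have kt : (k, t) \in places X by rewrite -pj mem_nth.
  have [_ /(_ t)] := wX k; rewrite /B' -pj index_uniq ?uniq_places// valK pj; apply.
  by move: kt; rewrite mem_places; lia.
rewrite iid// prod_path_law; congr (_ * _)%E.
case: (posnP (size (labels m))) => [s0|s0].
  rewrite [RHS]big1; last by move=> j; have := ltn_ord j; rewrite {2}s0.
  by rewrite (size0nil (_ : size (sorted_slots X) = 0%N)) ?big_nil// -size_labels.
have [q0 _] : exists q0 : 'I_N * 'I_N * ('I_n * nat), True.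
  by move: s0; rewrite size_labels; case: (sorted_slots X) => // q ? _; exists q.
rewrite (big_nth q0) -size_labels big_mkord; apply: eq_bigr => j _.
have j_lt : (j < size (sorted_slots X))%N by rewrite -size_labels.
congr (rlaw _ _ _).
  rewrite /label (tnth_nth q0.1)/=.
  transitivity (nth q0.1 (unzip1 (sorted_slots X)) j); first by rewrite (nth_map q0).
  by rewrite unzip1_sorted_slots.
rewrite /B' -surjective_pairing -(nth_map _ q0.2 snd)// -/(unzip2 _) -/(places X).
by rewrite index_uniq ?uniq_places ?size_places// valK.
Qed.

(** Given the paths, the ordered rewards have law [Q m]. Both sides are finite measures in [A] that
    agree on boxes. *)
Lemma robs_at_law X (m := step_counts X) A : measurable A ->
  (P th (states_event X `&` robs_at Z X m @^-1` A) =
   (sample_weight X)%:E * Q m (rparam th) A)%E.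
Proof.
have c0 := sample_weight_ge0 X.
pose m2 := mscale (NngNum c0) (Q m (rparam th)).
pose m1 := pushforward_measure (mrestr (P th) (measurable_states_event X))
  (@measurable_robs_at _ _ _ _ _ Z X m).
have m1E B : m1 B = P th (states_event X `&` robs_at Z X m @^-1` B).
  by rewrite /m1 /= /pushforward /mrestr setIC.
rewrite -m1E => mA; apply: (@tuple_measure_unique _ _ m1 m2) => // [|B mB].
  rewrite m1E (le_lt_trans (probability_le1 _ _)) ?ltry//.
  by rewrite preimage_setT setIT; exact: measurable_states_event.
by rewrite m1E robs_at_box_law.
Qed.

Lemma states_event_law X : P th (states_event X) = (sample_weight X)%:E.
Proof.
have := @robs_at_law X _ measurableT.
by rewrite preimage_setT setIT probability_setT mule1.
Qed.

Lemma ae_complete (s : 'I_N) :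
  {ae P th, forall w, forall k, complete_path start edge s (states Z k w)}.
Proof.
apply: ae_states => X.
case: (boolP [forall k, complete_path start edge s (X k)]) => [/forallP XC|].
  rewrite (_ : mkset _ = set0); first exact: negligible_set0.
  by apply/seteqP; split => // w [wX]; apply => k; rewrite wX.
move=> /forallPn[k nk]; exists (states_event X); split.
- exact: measurable_states_event.
- apply: etrans (states_event_law X) _; rewrite /sample_weight (bigD1 k)//=.
  by rewrite (path_weight_eq0 th_valid nk) mul0r.
- by move=> w [].
Qed.

(** On an event with constant paths the random counts are constant, and null sets of [Q m] pull back
    to null sets. Counts of complete paths are feasible, so nothing is asked of other counts. *)
Lemma ae_robs (s : 'I_N) (F : forall m, robs R m -> Prop) :
  (forall m, feasible edge m -> {ae Q m (rparam th), forall y, F m y}) ->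
  {ae P th, forall w, F (mu Z w) (robs_of Z (mu Z w) w)}.
Proof.
move=> FQ; have cX := ae_complete s.
suff : {ae P th, forall w, (forall k, complete_path start edge s (states Z k w)) ->
    F (mu Z w) (robs_of Z (mu Z w) w)}.
  by apply: filterS2 cX => w wC; exact.
apply: ae_states => X.
case: (boolP [forall k, complete_path start edge s (X k)]) => [/forallP XC|]; last first.
  move=> /forallPn[k nk]; rewrite (_ : mkset _ = set0); first exact: negligible_set0.
  apply/seteqP; split => // w [wX]; apply => /(_ k); rewrite wX => ck.
  by rewrite ck in nk.
have [A [mA A0 FA]] := FQ _ (feasible_step_counts XC).
exists (states_event X `&` robs_at Z X (step_counts X) @^-1` A); split.
- apply: measurableI; first exact: measurable_states_event.
  by rewrite -[X in measurable X]setTI; exact: measurable_robs_at.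
- apply: etrans (robs_at_law mA) _.
  by rewrite (A0 : Q (step_counts X) (rparam th) A = 0%E) mule0.
- move=> w [wX /not_implyP[_ nF]]; split => //; apply: FA => /= FX; apply: nF.
  have muX : mu Z w = step_counts X.
    by apply/ffunP => e; rewrite !ffunE; apply: eq_bigr => k _; rewrite wX.
  by rewrite muX (robs_of_at _ wX).
Qed.

Lemma integral_robs_at X (m := step_counts X) (f : robs R m -> \bar R) :
  measurable_fun setT f -> (forall y, 0 <= f y)%E ->
  (\int[P th]_(w in states_event X) f (robs_at Z X m w) =
   (sample_weight X)%:E * \int[Q m (rparam th)]_y f y)%E.
Proof.
move=> mf f0; have c0 := sample_weight_ge0 X.
have mY := @measurable_robs_at _ _ _ _ _ Z X m.
rewrite -(@ge0_integral_mrestr R _ _ (P th) _ (measurable_states_event X))//; last first.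
  exact: measurableT_comp.
rewrite -(@ge0_integral_pushforward _ _ _ _ _ _ mY _ setT f)//.
rewrite -[(sample_weight X)%:E]/((NngNum c0)%:num%:E) -ge0_integral_mscale//.
apply: eq_measure_integral => A mA _.
by rewrite /= /pushforward /mrestr /mscale/= setIC robs_at_law.
Qed.

End SampleLaw.

(** * Expected length of the sample *)

Section Absorption.
Context (R : realType) (N : nat) (start : {set 'I_N}) (edge : rel 'I_N).
Context (M : reward_model R N) (th : parameter M).
Hypothesis th_valid : valid start edge th.

(** Probability of making at least [t] transitions from [i]. *)
Definition survival_from (t : nat) (i : 'I_N) : R := \sum_j (trans th ^+ t) i j.

Definition survival (t : nat) : R := \sum_i (init th *m trans th ^+ t) 0 i.

Lemma sum_trans i : \sum_j trans th i j = (~~ terminal edge i)%:R.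
Proof.
case: th_valid => _ [trans0 trans1] _ transP _.
case: (boolP (terminal edge i)) => [/forallP ti|/trans1 //].
rewrite big1// => j _; apply/eqP; rewrite eq_le trans0 andbT leNgt transP.
exact: ti.
Qed.

Lemma trans_expr_ge0 t i j : 0 <= (trans th ^+ t) i j.
Proof. exact/mulmx_expr_ge0/(trans_ge0 th_valid). Qed.

Lemma survival_fromS t i :
  survival_from t.+1 i = \sum_j trans th i j * survival_from t j.
Proof.
rewrite /survival_from; under eq_bigr do rewrite exprS -mulmxE mxE.
by rewrite exchange_big; apply: eq_bigr => j _; rewrite mulr_sumr.
Qed.

Lemma survival_fromD t u : survival (t + u) =
  \sum_i (init th *m trans th ^+ t) 0 i * survival_from u i.
Proof.
rewrite /survival /survival_from exprD -mulmxE mulmxA.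
under eq_bigr do rewrite mxE.
by rewrite exchange_big; apply: eq_bigr => j _; rewrite mulr_sumr.
Qed.

Lemma init_trans_ge0 t i : 0 <= (init th *m trans th ^+ t) 0 i.
Proof.
apply: mulmx_ge0 => a b; last exact: trans_expr_ge0.
by rewrite ord1; exact: (init_ge0 th_valid).
Qed.

Lemma survival_from_ge0 t i : 0 <= survival_from t i.
Proof. by apply: sumr_ge0 => j _; exact: trans_expr_ge0. Qed.

Lemma survival_ge0 t : 0 <= survival t.
Proof. by apply: sumr_ge0 => j _; exact: init_trans_ge0. Qed.

Fixpoint paths_upto (L : nat) : seq (seq 'I_N) :=
  if L is L'.+1 then
    [::] :: [seq i :: xs | i <- enum 'I_N, xs <- paths_upto L']
  else [:: [::]].

Lemma mem_paths_upto L xs : (xs \in paths_upto L) = (size xs <= L)%N.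
Proof.
elim: L xs => [|L IH] [|x xs] //=; rewrite inE/=.
apply/allpairsP/idP => [[[y ys] /= [_ ysL [_ ->]]]|xs_le]; first by rewrite IH in ysL.
by exists (x, xs); rewrite mem_enum IH.
Qed.

Lemma uniq_paths_upto L : uniq (paths_upto L).
Proof.
elim: L => //= L IH; apply/andP; split; first by apply/allpairsP => -[[]] ? ? [].
by apply: allpairs_uniq => //; [exact: enum_uniq|move=> [? ?] [? ?] _ _ [-> ->]].
Qed.

Lemma sum_paths_uptoS L (F : seq 'I_N -> R) : \sum_(xs <- paths_upto L.+1) F xs =
  F [::] + \sum_i \sum_(xs <- paths_upto L) F (i :: xs).
Proof. by rewrite /= big_cons big_allpairs_dep big_enum. Qed.

(** The sum is the probability of being absorbed within [L] transitions from [i]; the alternative is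
    to make at least [L.+1]. *)
Lemma sum_weight_from L i :
  \sum_(xs <- paths_upto L) weight_from edge th i xs = 1 - survival_from L.+1 i.
Proof.
elim: L i => [|L IH] i.
  rewrite /= big_seq1 /= survival_fromS /survival_from.
  under eq_bigr => j _.
    rewrite expr0 (bigD1 j)//= mxE eqxx big1 ?addr0 ?mulr1; last first.
      by move=> k kj; rewrite mxE eq_sym (negbTE kj).
    over.
  by rewrite sum_trans; case: terminal => /=; rewrite ?subr0 ?subrr.
rewrite sum_paths_uptoS/=; under eq_bigr do rewrite -mulr_sumr IH mulrBr mulr1.
rewrite sumrB sum_trans -survival_fromS addrA; congr (_ - _).
by case: terminal => /=; rewrite ?addr0 ?add0r.
Qed.

Lemma sum_path_weight L :
  \sum_(xs <- paths_upto L) path_weight edge th xs = 1 - survival L.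
Proof.
have init1 : \sum_i init th 0 i = 1 by case: th_valid => -[].
case: L => [|L].
  by rewrite /= big_seq1 /survival expr0 mulmx1 init1 subrr.
rewrite sum_paths_uptoS/= add0r.
under eq_bigr do rewrite -mulr_sumr sum_weight_from mulrBr mulr1.
rewrite sumrB init1 -[L.+1]add0n survival_fromD expr0 mulmx1.
by [].
Qed.

Lemma survival_le1 t : survival t <= 1.
Proof.
rewrite -subr_ge0 -sum_path_weight; apply: sumr_ge0 => xs _.
exact: (path_weight_ge0 th_valid).
Qed.

(* Every reachable state is left towards absorption, so after some fixed time
   [T] survival halves: this is geometric decay. *)
Lemma survival_halves : exists T, forall t, survival (t + T) <= survival t / 2.
Proof.
have [T TP] : exists T, forall i, (exists t, 0 < (init th *m trans th ^+ t) 0 i) ->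
    survival_from T i <= 1 / 2.
  suff : \forall T \near \oo, forall i : 'I_N,
      (exists t, 0 < (init th *m trans th ^+ t) 0 i) -> survival_from T i <= 1 / 2.
    by move=> [T _ TP]; exists T; exact: (TP T (leqnn T)).
  apply: filter_forall => i.
  have [[t0 it0]|ni] := pselect (exists t, 0 < (init th *m trans th ^+ t) 0 i); last first.
    by apply: nearW => T /ni.
  have c0 : survival t @[t --> \oo] --> (0 : R) by case: th_valid.
  (* State [i] is occupied at time [t0] with probability [p]. Once survival at [t0 + t] is below
     [p / 2], surviving [t] steps from [i] has probability below one half. *)
  set p := (_ *m _) 0 i in it0.
  have p2 : 0 < p / 2 by rewrite divr_gt0.
  move: c0 => /(cvgr_lt 0)/(_ _ p2)[T _ TP]; exists T => // t /= Tt _.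
  have := TP (t0 + t)%N; rewrite /= (leq_trans Tt (leq_addl _ _)) => /(_ isT).
  rewrite survival_fromD (bigD1 i)//= -/p => lt2.
  rewrite -(ler_pM2l it0) mul1r; apply: ltW; apply: le_lt_trans lt2.
  rewrite lerDl; apply: sumr_ge0 => j _.
  by rewrite mulr_ge0 ?init_trans_ge0 ?survival_from_ge0.
exists T => t; rewrite survival_fromD /survival mulr_suml; apply: ler_sum => i _.
have := init_trans_ge0 t i; rewrite le_eqVlt => /predU1P[<-|ti].
  by rewrite !mul0r.
by rewrite ler_pM2l// (le_trans (TP _ _)) ?mul1r//; exists t.
Qed.

Lemma sum_survival_bounded : exists C, forall m, \sum_(t < m) survival t <= C.
Proof.
(* The partial sum is at most [T] plus half of itself: the first [T] terms are at most 1, and each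
   later one is at most half of the term [T] places before it. *)
have [T TP] := survival_halves; exists (2 * T%:R) => m.
have le1 : \sum_(t < m) survival t <= \sum_(t < T + m) survival t.
  rewrite -!(big_mkord predT survival) (@big_cat_nat _ _ _ m 0 (T + m))//=; last first.
    exact: leq_addl.
  by rewrite lerDl sumr_ge0// => t _; exact: survival_ge0.
have le2 : \sum_(t < T + m) survival t <= T%:R + (\sum_(t < m) survival t) / 2.
  rewrite big_split_ord/= lerD//.
    have -> : T%:R = \sum_(t < T) (1 : R) by rewrite sumr_const card_ord.
    by apply: ler_sum => t _; exact: survival_le1.
  rewrite mulr_suml; apply: ler_sum => t _; rewrite addnC; exact: TP.
by move: le1 le2; lra.
Qed.

End Absorption.

Section ExpectedLength.
Context (R : realType) (N n : nat) (start : {set 'I_N}) (edge : rel 'I_N).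
Context (M : reward_model R N).
Context (Q : forall m : counts N, rpar M -> probability (robs R m) R).
Context (d : measure_display) (Omega : measurableType d).
Context (P : parameter M -> probability Omega R) (Z : sample R N n Omega).
Hypothesis indep : independent_rewards Q.
Hypothesis iid : iid_sample start edge P Z.
Context (th : parameter M).
Hypothesis th_valid : valid start edge th.

Definition short_paths (L : nat) : set Omega :=
  [set w | forall k, (size (states Z k w) <= L)%N].

Lemma measurable_short_paths L : measurable (short_paths L).
Proof.
rewrite (_ : short_paths L =
    \bigcup_i (states_class Z i `&` short_paths L)); last first.
  by rewrite -setI_bigcupl bigcup_states_class setTI.
apply: bigcupT_measurable => i; rewrite /states_class.
case: pickle_inv => [X|]; last by rewrite set0I.
case: (boolP [forall k, size (X k) <= L]%N) => [/forallP XL|/forallPn[k kL]].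
  rewrite setIidl; first exact: measurable_states_event.
  by move=> w wX k; rewrite wX.
rewrite (_ : _ `&` _ = set0)//; apply/seteqP; split => // w [wX /(_ k)].
by rewrite wX => XL; rewrite XL in kL.
Qed.

Lemma sum_seq_sub (T : choiceType) (r : seq T) (F : T -> R) : uniq r ->
  \sum_(x : seq_sub r) F (val x) = \sum_(x <- r) F x.
Proof.
move=> ur; rewrite -(big_map val predT F); apply: perm_big; apply: uniq_perm => //.
  by rewrite map_inj_uniq ?index_enum_uniq//; exact: val_inj.
move=> x; apply/mapP/idP => [[y _ ->]|xr]; first exact: valP.
by exists (SeqSub xr) => //; rewrite mem_index_enum.
Qed.

Lemma short_paths_law L : P th (short_paths L) = ((1 - survival th L) ^+ n)%:E.
Proof.
(* A finite type of short paths: the sum over all choices of [n] of them becomes an [n]-th power by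
   distributivity. *)
pose J := seq_sub (paths_upto N L).
pose S (Y : {ffun 'I_n -> J}) := states_event Z (fun k => val (Y k)).
have mS Y : measurable (S Y) by exact: measurable_states_event.
have indicE w : ((\1_(short_paths L) w)%:E = \sum_Y (\1_(S Y) w)%:E :> \bar R)%E.
  rewrite sumEFin; congr (_%:E).
  have [wL|wL] := pselect (short_paths L w); last first.
    rewrite indicE memNset// big1// => Y _; rewrite indicE memNset// => wY.
    by apply: wL => k; rewrite wY -mem_paths_upto; exact: valP.
  have wJ k : states Z k w \in paths_upto N L by rewrite mem_paths_upto.
  pose Y0 : {ffun 'I_n -> J} := [ffun k => SeqSub (wJ k)].
  rewrite indicE mem_set// (bigD1 Y0)//= big1 ?addr0 => [|Y YY0].
    by rewrite indicE mem_set// => k; rewrite ffunE.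
  rewrite indicE memNset// => wY; move/negP: YY0; apply; apply/eqP/ffunP => k.
  by apply: val_inj; rewrite ffunE -wY.
rewrite -[short_paths L]setIT -integral_indic//; last exact: measurable_short_paths.
rewrite (eq_integral (fun w => \sum_Y (\1_(S Y) w)%:E)%E) => [|w _]; last exact: indicE.
rewrite ge0_integral_sum//; last first.
  by move=> Y; apply/measurable_EFinP; exact: measurable_indic.
transitivity (\sum_(Y : {ffun 'I_n -> J})
    (\prod_k path_weight edge th (val (Y k)))%:E)%E.
  apply: eq_bigr => Y _; rewrite integral_indic// setIT.
  exact: (states_event_law indep iid th_valid).
rewrite sumEFin -(bigA_distr_bigA (fun _ (y : J) => path_weight edge th (val y)))/=.
rewrite -(sum_path_weight th_valid) -(sum_seq_sub _ (uniq_paths_upto N L)).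
by rewrite prodr_const card_ord.
Qed.

Lemma long_paths_le L : (P th (~` short_paths L) <= (n%:R * survival th L)%:E)%E.
Proof.
rewrite probability_setC; last exact: measurable_short_paths.
rewrite short_paths_law -EFinB lee_fin.
have a0 := survival_ge0 th_valid L; have a1 := survival_le1 th_valid L.
move: a0 a1; move: (survival th L) => a a0 a1; rewrite lerBlDl -lerBlDr.
(* Bernoulli's inequality. *)
elim: n => [|k IH]; first by rewrite mul0r expr0 subr0.
rewrite exprS -addn1 natrD mulrDl mul1r.
have p1 : (1 - a) ^+ k <= 1 by rewrite exprn_ile1; lra.
have p0 : 0 <= (1 - a) ^+ k by rewrite exprn_ge0; lra.
nra.
Qed.

Definition sample_length (w : Omega) : nat := (\sum_k (size (states Z k w)).-1)%N.

(** A tail sum: the greatest path length is the number of those [L] that some path exceeds, and the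
    [n] paths together make at most [n] times as many transitions. *)
Lemma sample_length_le w : ((sample_length w)%:R%:E <=
  \sum_(L <oo) (n%:R * \1_(~` short_paths L) w)%:E :> \bar R)%E.
Proof.
pose A := \max_k size (states Z k w).
apply: le_trans (nneseries_lim_ge A _); last first.
  by move=> L _ _; rewrite lee_fin mulr_ge0.
rewrite big_mkord sumEFin lee_fin -mulr_sumr.
have -> : \sum_(L < A) \1_(~` short_paths L) w = A%:R :> R.
  rewrite (eq_bigr (fun=> 1)) => [|L _]; first by rewrite sumr_const card_ord.
  rewrite indicE mem_set// => wL; have := ltn_ord L; rewrite ltnNge => /negP; apply.
  by apply/bigmax_leqP => k _; exact: wL.
rewrite -natrM ler_nat -[X in (X * _)%N]card_ord -sum_nat_const leq_sum// => k _.
apply: leq_trans (leq_pred _) _.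
exact: (leq_bigmax (F := fun k => size (states Z k w)) k).
Qed.

Lemma measurable_sample_length :
  measurable_fun setT (fun w => (sample_length w)%:R : R).
Proof.
apply: (@measurable_fun_states _ _ _ _ _ Z) => X.
exists (cst ((\sum_k (size (X k)).-1)%N%:R)) => //= w wX; congr (_%:R).
by apply: eq_bigr => k _; rewrite wX.
Qed.

Lemma sample_length_integral : (\int[P th]_w (sample_length w)%:R%:E < +oo)%E.
Proof.
have mI L : measurable_fun setT (fun w => (n%:R * \1_(~` short_paths L) w)%:E : \bar R).
  apply/measurable_EFinP; apply: measurable_funM => //.
  by apply: measurable_indic; apply: measurableC; exact: measurable_short_paths.
have I0 L w : (0 <= (n%:R * \1_(~` short_paths L) w)%:E :> \bar R)%E.
  by rewrite lee_fin mulr_ge0.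
have [C CP] := sum_survival_bounded th_valid.
apply: (@le_lt_trans _ _ (\int[P th]_w \sum_(L <oo) (n%:R * \1_(~` short_paths L) w)%:E)%E).
  apply: ge0_le_integral => //.
  - by apply/measurable_EFinP; exact: measurable_sample_length.
  - by apply: ge0_emeasurable_sum.
  - by move=> w _; exact: sample_length_le.
rewrite integral_nneseries//.
(* One factor [n] comes from the tail sum, the other from the union bound [long_paths_le]. *)
apply: (@le_lt_trans _ _ (n%:R * (n%:R * C))%:E); last by rewrite ltry.
apply: lime_le; first by apply: is_cvg_nneseries => L _ _; exact: integral_ge0.
apply: nearW => m; rewrite /= big_mkord.
apply: (@le_trans _ _ (\sum_(L < m) (n%:R * (n%:R * survival th L))%:E)%E).
  apply: lee_sum => L _; under eq_integral do rewrite EFinM.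
  rewrite ge0_integralZl//; last by apply/measurable_EFinP; apply: measurable_indic;
    apply: measurableC; exact: measurable_short_paths.
  rewrite integral_indic ?setIT//; last by apply: measurableC; exact: measurable_short_paths.
  by rewrite EFinM lee_wpmul2l ?lee_fin ?long_paths_le.
by rewrite sumEFin lee_fin -!mulr_sumr !ler_wpM2l.
Qed.

End ExpectedLength.

(** * Mean rewards *)

Section RewardObservations.
Context (R : realType) (N : nat) (edge : rel 'I_N) (M : reward_model R N).
Context (Q : forall m : counts N, rpar M -> probability (robs R m) R).
Hypothesis M_ok : reward_model_ok edge M.
Hypothesis indep : independent_rewards Q.
Implicit Types (m : counts N) (l : rpar M).

Lemma count_labels m e : count_mem e (labels m) = m e.
Proof.
rewrite count_flatten -map_comp sumnE big_map big_enum/= (bigD1 e)//=.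
rewrite count_nseq /= eqxx mul1n big1 ?addn0// => i /negbTE ie.
by rewrite count_nseq /= ie mul0n.
Qed.

Lemma card_label m e : #|[pred k : 'I_(size (labels m)) | label k == e]| = m e.
Proof.
rewrite -count_labels; transitivity (count_mem e (tval (in_tuple (labels m)))) => //.
by rewrite -[tval _]map_tnth_enum -sum1_card -sum1_count big_map big_enum_cond.
Qed.

Lemma label_edge m (k : 'I_(size (labels m))) : feasible edge m ->
  edge (label k).1 (label k).2.
Proof.
move=> fm; apply: fm; rewrite -count_labels -has_count has_pred1.
exact: mem_tnth.
Qed.

Lemma robs_marginal m l (j : 'I_(size (labels m))) (B : set R) : measurable B ->
  Q m l ((fun y => tnth y j) @^-1` B) = rlaw l (label j) B.
Proof.
move=> mB; have := indep l (B := fun k => if k == j then B else setT).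
rewrite (bigD1 j)//= eqxx big1 ?mule1; last first.
  by move=> k /negbTE ->; exact: probability_setT.
move=> <-; last by move=> k; case: ifP.
congr (Q m l _); apply/seteqP; split => y /= yB; last by have := yB j; rewrite eqxx.
by move=> k; case: eqP => // ->.
Qed.

Lemma integral_tnth m l (j : 'I_(size (labels m))) (f : R -> \bar R) :
  measurable_fun setT f -> (forall x, 0 <= f x)%E ->
  (\int[Q m l]_y f (tnth y j) = \int[rlaw l (label j)]_x f x)%E.
Proof.
move=> mf f0.
rewrite -(@ge0_integral_pushforward _ _ _ _ _ _ (measurable_tnth j) (Q m l) setT f)//.
apply: eq_measure_integral; first exact: measurable_tnth.
by move=> mt_ A mA _; exact: (robs_marginal l j mA).
Qed.

Lemma integrable_tnth m l (j : 'I_(size (labels m))) : feasible edge m ->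
  (Q m l).-integrable setT (fun y => (tnth y j)%:E) /\
  (\int[Q m l]_y (tnth y j)%:E = (rmean l (label j))%:E)%E.
Proof.
move=> fm; have [ri _ _ _] := M_ok l (label_edge j fm).
have mt : measurable_fun setT (fun y : robs R m => (tnth y j)%:E).
  by apply/measurable_EFinP; exact: measurable_tnth.
have ti : (Q m l).-integrable setT (fun y => (tnth y j)%:E).
  apply/integrableP; split => //.
  rewrite (@integral_tnth _ _ _ (fun x => `|x%:E|)%E)//.
    by case/integrableP: ri.
  by apply: measurableT_comp.
split => //.
have := @integral_pushforward _ _ _ _ _ _ (measurable_tnth j) (Q m l) setT EFin.
move=> /(_ _ ti measurableT) <-//.
rewrite /rmean /Rintegral fineK; last exact: (integrable_fin_num measurableT ri).
apply: eq_measure_integral; first exact: measurable_tnth.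
by move=> mt_ A mA _; exact: (robs_marginal l j mA).
Qed.

Lemma measurable_total_reward m e : measurable_fun setT (@total_reward R N m e).
Proof.
rewrite /total_reward; under eq_fun do rewrite big_mkcond/=.
apply: measurable_sum => k.
by case: (label k == e) => //; exact: measurable_tnth.
Qed.

Lemma total_reward_integral m e l : feasible edge m ->
  (Q m l).-integrable setT (EFin \o @total_reward R N m e) /\
  (\int[Q m l]_y (total_reward e y)%:E = ((m e)%:R * rmean l e)%:E)%E.
Proof.
move=> fm.
have sumE y : (total_reward e y)%:E = (\sum_(k | label k == e) (tnth y k)%:E)%E.
  by rewrite sumEFin.
have ti k : (Q m l).-integrable setT (fun y => (tnth y k)%:E).
  by have [] := integrable_tnth l k fm.
split.
  rewrite (_ : _ \o _ = fun y => \sum_(k | label k == e) (tnth y k)%:E)%E.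
    by apply: integrable_sum => // k _.
  by apply/funext => y; exact: sumE.
under eq_integral do rewrite sumE.
rewrite integral_sum//.
transitivity (\sum_(k : 'I_(size (labels m)) | label k == e) (rmean l e)%:E)%E.
  apply: eq_bigr => k /eqP ke; rewrite -ke.
  by have [_ ->] := integrable_tnth l k fm.
by rewrite sumEFin sumr_const card_label mulr_natl.
Qed.

Lemma unbiased_mean_reward m e : feasible edge m -> (0 < m e)%N ->
  unbiased (Q m) ((rmean (M:=M))^~ e) (fun y => total_reward e y / (m e)%:R).
Proof.
move=> fm me; split.
  by apply: measurable_funM => //; exact: measurable_total_reward.
move=> l; have [ti tE] := total_reward_integral e l fm.
have E y : ((total_reward e y / (m e)%:R)%:E = ((m e)%:R^-1)%:E * (total_reward e y)%:E)%E.
  by rewrite -EFinM mulrC.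
split.
  by apply: eq_integrable (integrableZl measurableT (m e)%:R^-1 ti) => // y _; rewrite /= E.
under eq_integral do rewrite E.
by rewrite integralZl// tE -EFinM mulKf// pnatr_eq0 -lt0n.
Qed.

Lemma rest_mean_reward (d : measure_display) (U : measurableType d)
    (T : forall m, robs R m -> U)
    (rest : forall m, 'I_N * 'I_N -> robs R m -> R) m e l :
  reward_assumption edge Q T rest -> feasible edge m -> (0 < m e)%N ->
  {ae Q m l, forall y, rest m e y = total_reward e y / (m e)%:R}.
Proof.
move=> [mT ra] fm me; have [sT cT dT optT] := ra m fm.
have [_ opt] := optT e me.
apply: (optimal_unbiased_complete (mT m) sT cT opt (unbiased_mean_reward fm me)).
have [g mg gE] := dT e; exists (fun u => g u / (m e)%:R).
  exact: measurable_funM.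
by move=> l'; apply: filterS (gE l') => y ->.
Qed.

(** A bound for the expected absolute reward that is uniform over possible transitions; a sum serves
    as well as a maximum. *)
Definition reward_bound l : R :=
  \sum_(e : 'I_N * 'I_N | edge e.1 e.2) fine (\int[rlaw l e]_x `|x%:E|)%E.

Lemma reward_bound_ge0 l : 0 <= reward_bound l.
Proof. by apply: sumr_ge0 => e _; rewrite fine_ge0// integral_ge0. Qed.

Lemma integral_abs_rewards m l : feasible edge m ->
  (\int[Q m l]_y (\sum_k `|tnth y k|)%:E <=
   ((size (labels m))%:R * reward_bound l)%:E)%E.
Proof.
move=> fm; under eq_integral do rewrite -sumEFin.
rewrite ge0_integral_sum//; last first.
  move=> k; apply/measurable_EFinP; apply: measurableT_comp => //.
  exact: measurable_tnth.
apply: (@le_trans _ _ (\sum_(k < size (labels m)) (reward_bound l)%:E)%E).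
  apply: lee_sum => k _.
  rewrite (@integral_tnth _ _ _ (fun x => `|x%:E|)%E)//; last first.
    by apply: measurableT_comp.
  have ke := label_edge k fm; have [ri _ _ _] := M_ok l ke.
  rewrite -[leLHS]fineK; last first.
    rewrite ge0_fin_numE ?integral_ge0//; by case/integrableP: ri.
  rewrite lee_fin /reward_bound (bigD1 (label k))//= lerDl sumr_ge0// => e _.
  by rewrite fine_ge0// integral_ge0.
by rewrite sumEFin lee_fin sumr_const card_ord mulr_natl.
Qed.

End RewardObservations.

(** * First-visit Monte Carlo *)

Section FullInformation.
Context (R : realType) (N n : nat) (start : {set 'I_N}) (edge : rel 'I_N).
Context (M : reward_model R N).
Context (Q : forall m : counts N, rpar M -> probability (robs R m) R).
Context (dU : measure_display) (U : measurableType dU).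
Context (T : forall m : counts N, robs R m -> U).
Context (rest : forall m : counts N, 'I_N * 'I_N -> robs R m -> R).
Context (d : measure_display) (Omega : measurableType d).
Context (P : parameter M -> probability Omega R) (Z : sample R N n Omega).
Context (s : 'I_N).
Hypothesis M_ok : reward_model_ok edge M.
Hypothesis indep : independent_rewards Q.
Hypothesis ra : reward_assumption edge Q T rest.
Hypothesis iid : iid_sample start edge P Z.
Hypothesis fi : full_information start edge s.

Notation paths w := (fun k => states Z k w).
Notation closed_total w := (\sum_(e | connect edge s e.1)
  total_reward e (robs_of Z (mu Z w) w)).

Lemma first_visit_MC_totals w :
  (forall k, complete_path start edge s (states Z k w)) ->
  first_visit_MC Z 1 s w = closed_total w / (path_count s (paths w))%:R.
Proof.
move=> wC; rewrite /first_visit_MC; congr (_ / _).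
under [RHS]eq_bigr do rewrite sum_total_reward.
transitivity (\sum_(er <- labelled_rewards Z w | connect edge s er.1.1) er.2).
  rewrite /labelled_rewards big_flatten big_map big_enum/= big_mkcond/=.
  apply: eq_bigr => k _; have /andP[kP _] := wC k.
  rewrite (sum_rewards_closure _ fi kP) /path_return.
  (* For a path that misses [s] the index is the length of the path, so the sum is empty. *)
  case: ifPn => [_|/memNindex ->]; last by rewrite big_geq// leq_pred.
  by apply: eq_bigr => t _; rewrite expr1n mul1r.
rewrite (partition_big fst (fun e => connect edge s e.1))//=.
apply: eq_bigr => e se; apply: eq_bigl => er.
by case: eqP => [->|]; rewrite ?se ?andbF.
Qed.

Lemma measurable_first_visit_MC : measurable_fun setT (first_visit_MC Z 1 s).
Proof.
apply: (@measurable_fun_states _ _ _ _ _ Z) => X.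
exists (fun w => (\sum_(k | s \in X k)
    \sum_(index s (X k) <= t < (size (X k)).-1) rewards Z k t w) /
    #|[pred k | s \in X k]|%:R).
  apply: measurable_funM => //; under eq_fun do rewrite big_mkcond/=.
  apply: measurable_sum => k; case: (s \in X k) => //.
  by apply: measurable_sum => t; exact: measurable_rewards.
move=> w wX; rewrite /first_visit_MC; congr (_ / _%:R); last first.
  by apply: eq_card => k; rewrite !inE wX.
apply: eq_big => [k|k _]; first by rewrite wX.
by rewrite /path_return wX; apply: eq_bigr => t _; rewrite expr1n mul1r.
Qed.

Lemma size_robs (X : 'I_n -> seq 'I_N) :
  size (labels (step_counts X)) = (\sum_(k < n) (size (X k)).-1)%N.
Proof.
rewrite size_labels (perm_size (perm_sorted_slots X)) -(size_map fst).
rewrite -/(unzip1 _) unzip1_slots size_flatten /shape -map_comp sumnE big_map.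
by rewrite big_enum; apply: eq_bigr => k _; rewrite /= size_steps.
Qed.

Lemma first_visit_MC_le X w : (forall k, complete_path start edge s (X k)) ->
  states_event Z X w ->
  `|first_visit_MC Z 1 s w| <= \sum_k `|tnth (robs_at Z X (step_counts X) w) k|.
Proof.
move=> XC wX; rewrite first_visit_MC_totals; last by move=> k; rewrite wX.
have muX : mu Z w = step_counts X.
  by apply/ffunP => e; rewrite !ffunE; apply: eq_bigr => k _; rewrite wX.
rewrite muX (robs_of_at _ wX); set y := robs_at _ _ _ _.
apply: (@le_trans _ _ `|\sum_(e | connect edge s e.1) total_reward e y|).
  rewrite normrM ler_piMr// normfV normr_nat.
  (* Without a path through [s] the quotient is 0; otherwise the divisor is at least 1. *)
  by case: path_count => [|q]; rewrite ?invr0// invf_le1 ?ler1n.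
apply: le_trans (ler_norm_sum _ _ _) _.
apply: (@le_trans _ _ (\sum_e \sum_(k | label k == e) `|tnth y k|)).
  rewrite big_mkcond; apply: ler_sum => e _; case: ifP => _.
    exact: ler_norm_sum.
  by apply: sumr_ge0.
by rewrite [leRHS](partition_big (fun k => label k) predT).
Qed.

(** A bound in the manner of Wald: for given paths the expected absolute rewards are at most [K] per
    transition, and the expected number of transitions is finite. *)
Lemma integrable_first_visit_MC th : valid start edge th ->
  (P th).-integrable setT (EFin \o first_visit_MC Z 1 s).
Proof.
move=> thV; pose K := reward_bound edge (rparam th).
have K0 : 0 <= K := reward_bound_ge0 edge _.
have mW := measurable_first_visit_MC.
apply/integrableP; split; first exact/measurable_EFinP.
apply: (@le_lt_trans _ _ (\int[P th]_w (K%:E * (sample_length Z w)%:R%:E))%E); last first.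
  rewrite ge0_integralZl//; last first.
    by apply/measurable_EFinP; exact: measurable_sample_length.
  by rewrite lte_mul_pinfty// (sample_length_integral indep iid thV).
apply: (@le_integral_states _ _ _ _ _ Z) => //.
- by apply: measurableT_comp => //; exact/measurable_EFinP.
- apply: emeasurable_funM => //.
  by apply/measurable_EFinP; exact: measurable_sample_length.
- by move=> w; rewrite mule_ge0// lee_fin.
move=> X; case: (boolP [forall k, complete_path start edge s (X k)]); last first.
  move=> /forallPn[k nk]; rewrite null_set_integral.
  - by apply: integral_ge0 => w _; rewrite mule_ge0// lee_fin.
  - exact: measurable_states_event.
  - by apply: measurable_funTS; apply: measurableT_comp => //; exact/measurable_EFinP.
  - apply: etrans (states_event_law indep iid thV X) _.
    rewrite /sample_weight (bigD1 k)//=.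
    by rewrite (path_weight_eq0 thV nk) mul0r.
move=> /forallP XC; have fm := feasible_step_counts XC.
pose h (y : robs R (step_counts X)) : \bar R := (\sum_k `|tnth y k|)%:E.
have mh : measurable_fun setT h.
  apply/measurable_EFinP; apply: measurable_sum => k.
  by apply: measurableT_comp => //; exact: measurable_tnth.
have h0 y : (0 <= h y)%E by rewrite lee_fin sumr_ge0.
apply: (@le_trans _ _ (\int[P th]_(w in states_event Z X) h (robs_at Z X (step_counts X) w))%E).
  apply: ge0_le_integral => //.
  - exact: measurable_states_event.
  - by apply: measurable_funTS; apply: measurableT_comp => //; exact/measurable_EFinP.
  - by apply: measurable_funTS; apply: measurableT_comp => //; exact: measurable_robs_at.
  - by move=> w wX; rewrite lee_fin; exact: first_visit_MC_le.
rewrite (integral_robs_at indep iid thV)//.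
rewrite (eq_integral (cst (K * (size (labels (step_counts X)))%:R)%:E)); last first.
  move=> w /set_mem wX; rewrite /= size_robs EFinM; congr (_ * _%:R%:E)%E.
  by apply: eq_bigr => k _; rewrite wX.
rewrite integral_cst; last exact: measurable_states_event.
rewrite [X in (_ <= _ * X)%E](states_event_law indep iid thV X) [leRHS]muleC.
rewrite lee_wpmul2l//; first by rewrite lee_fin (sample_weight_ge0 thV).
by rewrite mulrC (integral_abs_rewards M_ok indep).
Qed.

Lemma sigma_suff_statI : setI_closed (sigma_suff_stat Z T).
Proof.
move=> _ _ [C mC <-] [C' mC' <-]; exists (C `&` C'); last by rewrite !setTI preimage_setI.
by move=> a m; apply: measurableI; [exact: mC|exact: mC'].
Qed.

(** For constant paths the counts are constant, so only one section of [C] matters, and sections are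
    what the definition requires to be measurable. *)
Lemma sigma_suff_stat_measurable : sigma_suff_stat Z T `<=` measurable.
Proof.
move=> _ [C mC <-]; rewrite setTI.
have [mT _] := ra.
rewrite (_ : _ @^-1` C =
    \bigcup_i (states_class Z i `&` suff_stat Z T @^-1` C)); last first.
  by rewrite -setI_bigcupl bigcup_states_class setTI.
apply: bigcupT_measurable => i; rewrite /states_class.
case: pickle_inv => [X|]; last by rewrite set0I.
pose a : {ffun 'I_N -> nat} := [ffun j => #|[pred k | ohead (X k) == Some j]|].
pose m := step_counts X.
rewrite (_ : _ `&` _ = states_event Z X `&`
    (setT `&` (@T m \o robs_at Z X m) @^-1` [set u | C (a, m, u)])).
  apply: measurableI; first exact: measurable_states_event.
  have mTY : measurable_fun setT (@T m \o robs_at Z X m).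
    by apply: measurableT_comp; [exact: mT|exact: measurable_robs_at].
  exact: (mTY measurableT _ (mC a m)).
have SX w : states_event Z X w ->
    suff_stat Z T w = (a, m, T (robs_at Z X m w)).
  move=> wX; have muX : mu Z w = m.
    by apply/ffunP => e; rewrite !ffunE; apply: eq_bigr => k _; rewrite wX.
  have aX : start_counts Z w = a.
    by apply/ffunP => j; rewrite !ffunE; apply: eq_card => k; rewrite !inE wX.
  by rewrite /suff_stat aX muX (robs_of_at _ wX).
by rewrite setTI; apply/seteqP; split => w [wX]; rewrite /= SX.
Qed.

Lemma closed_totals_statistic : exists g : counts N -> 'I_N * 'I_N -> U -> R,
  (forall m e, measurable_fun setT (g m e)) /\
  forall m, feasible edge m -> forall l e,
    {ae Q m l, forall y, total_reward e y = g m e (T y)}.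
Proof.
have [_ ra'] := ra.
have /choice[g gP] : forall me : counts N * ('I_N * 'I_N), exists g : U -> R,
    measurable_fun setT g /\ (feasible edge me.1 -> forall l,
      {ae Q me.1 l, forall y, total_reward me.2 y = g (T y)}).
  move=> [m e]; have [fm|nfm] := pselect (feasible edge m); last first.
    (* A dummy for infeasible counts, which almost surely do not occur. *)
    by exists (cst 0); split.
  have [_ _ /(_ e)[g mg gE] _] := ra' m fm.
  by exists g; split.
exists (fun m e => g (m, e)); split => [m e|m fm l e].
  by have [] := gP (m, e).
by have [_ /(_ fm l)] := gP (m, e).
Qed.

Lemma ae_rewards th : valid start edge th ->
  forall g : counts N -> 'I_N * 'I_N -> U -> R,
  (forall m, feasible edge m -> forall l e,
    {ae Q m l, forall y, total_reward e y = g m e (T y)}) ->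
  {ae P th, forall w, (forall k, complete_path start edge s (states Z k w)) /\
    let m := mu Z w in let y := robs_of Z m w in forall e,
      total_reward e y = g m e (T y) /\
      ((0 < m e)%N -> rest e y = total_reward e y / (m e)%:R)}.
Proof.
move=> thV g gP.
have cC := ae_complete indep iid thV s.
pose F m (y : robs R m) := forall e, total_reward e y = g m e (T y) /\
      ((0 < m e)%N -> rest e y = total_reward e y / (m e)%:R).
have : {ae P th, forall w, F (mu Z w) (robs_of Z (mu Z w) w)}.
  apply: (ae_robs indep iid thV s) => m fm; apply: filter_forall => e.
  case: (posnP (m e)) => [m0|m0].
    by apply: filterS (gP m fm (rparam th) e) => y yg; split => //; rewrite m0.
  by apply: filterS2 (gP m fm (rparam th) e)
    (rest_mean_reward M_ok indep (rparam th) ra fm m0) => y.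
by apply: filterS2 cC => w.
Qed.

Lemma total_reward_eq0 (m : counts N) e (y : robs R m) : m e = 0%N -> total_reward e y = 0.
Proof.
move=> m0; apply: big1 => k ke; have := card_label m e.
by rewrite m0 => /card0_eq/(_ k); rewrite inE ke.
Qed.

Lemma ml_value_totals w : (forall k, complete_path start edge s (states Z k w)) ->
  (forall e, (0 < mu Z w e)%N -> rest e (robs_of Z (mu Z w) w) =
     total_reward e (robs_of Z (mu Z w) w) / (mu Z w e)%:R) ->
  (1 <= visits Z s w)%N ->
  ml_series Z rest 1 s w @ \oo --> closed_total w / (path_count s (paths w))%:R.
Proof.
move=> wC restE sw; set y := robs_of Z (mu Z w) w.
have := empirical_value wC fi (rho := fun e => rest e y) sw.
rewrite (_ : \sum_(e | _) _ = closed_total w); last first.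
  (* On an unobserved transition nothing is known of [rest], but its weight is 0 and so is the total
     reward. *)
  apply: eq_bigr => e _; case: (posnP (mu Z w e)) => [m0|m0].
    by rewrite total_reward_eq0// (m0 : step_counts _ e = 0%N) mul0r.
  by rewrite restE// mulrC divfK// pnatr_eq0 -lt0n.
by [].
Qed.

Lemma first_visit_MC_statistic : exists V, forall th, valid start edge th ->
  is_cond_exp (P th) (sigma_suff_stat Z T) (first_visit_MC Z 1 s) V /\
  {ae P th, forall w, first_visit_MC Z 1 s w = V w}.
Proof.
have [g [mg gP]] := closed_totals_statistic.
(* The denominator is the number of paths through [s], recovered from start and transition counts by
   [path_count_from_counts]. *)
pose V0 (amu : {ffun 'I_N -> nat} * counts N * U) : R :=
  (\sum_(e | connect edge s e.1) g amu.1.2 e amu.2) /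
  (amu.1.1 s + \sum_(i | ~~ connect edge s i) amu.1.2 (i, s))%N%:R.
exists (V0 \o suff_stat Z T) => th thV.
have VE : {ae P th, forall w, first_visit_MC Z 1 s w = V0 (suff_stat Z T w)}.
  apply: filterS (ae_rewards thV gP) => w [wC wg].
  rewrite first_visit_MC_totals// /V0 /= (path_count_from_counts wC fi).
  congr (_ / _%:R); last by rewrite /start_counts ffunE.
  by apply: eq_bigr => e _; have [] := wg e.
split => //; apply: is_cond_exp_ae => //.
- exact: sigma_suff_stat_measurable.
- exact: integrable_first_visit_MC.
move=> B mB; exists (V0 @^-1` B); last by rewrite setTI.
move=> a m; rewrite -[X in measurable X]setTI.
suff : measurable_fun setT (fun u => V0 (a, m, u)) by apply.
apply: measurable_funM => //=; under eq_fun do rewrite big_mkcond/=.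
by apply: measurable_sum => e; case: (connect edge s e.1).
Qed.

End FullInformation.

Theorem corollary7 (R : realType) (N n : nat)
    (start : {set 'I_N}) (edge : rel 'I_N)
    (M : reward_model R N)
    (Q : forall m : counts N, rpar M -> probability (robs R m) R)
    (dU : measure_display) (U : measurableType dU)
    (T : forall m : counts N, robs R m -> U)
    (rest : forall m : counts N, 'I_N * 'I_N -> robs R m -> R)
    (d : measure_display) (Omega : measurableType d)
    (P : parameter M -> probability Omega R)
    (Z : sample R N n Omega) (s : 'I_N) :
  (1 <= n)%N ->
  reward_model_ok edge M ->
  independent_rewards Q ->
  reward_assumption edge Q T rest ->
  iid_sample start edge P Z ->
  full_information start edge s ->
  (exists V, is_MVU start edge Z T P 1 s V) /\
  forall V, is_MVU start edge Z T P 1 s V ->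
  forall th : parameter M, valid start edge th ->
  {ae P th, forall w, (1 <= visits Z s w)%N ->
    [/\ first_visit_MC Z 1 s w = V w,
        cvgn (ml_series Z rest 1 s w)
      & first_visit_MC Z 1 s w = ml_value Z rest 1 s w]}.
Proof.
move=> _ M_ok indep ra iid fi.
have [V0 V0P] := first_visit_MC_statistic M_ok indep ra iid fi.
split; first by exists V0 => th thV; have [] := V0P th thV.
move=> V VP th thV; have [V0E WV0] := V0P th thV.
have sI : setI_closed (sigma_suff_stat Z T) by exact: sigma_suff_statI.
have sm : sigma_suff_stat Z T `<=` measurable.
  by apply: sigma_suff_stat_measurable; exact: ra.
(* An MVU is any version of the conditional expectation, so it agrees with the explicit one only
   almost surely. *)
have VV0 := cond_exp_unique sI sm (VP th thV) V0E.
have [g [_ gP]] := closed_totals_statistic ra.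
have rw := ae_rewards s M_ok indep ra iid thV gP.
have : {ae P th, forall w, first_visit_MC Z 1 s w = V w}.
  by apply: filterS2 WV0 VV0 => w -> ->.
apply: filterS2 rw => w [wC wE] WV sw.
have ml := ml_value_totals fi wC (fun e => (wE e).2) sw.
split => //; first by apply/cvg_ex; eexists; exact: ml.
by rewrite (first_visit_MC_totals fi wC); apply/esym/cvg_lim.
Qed.
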